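(* For every pair of positive integers $d$ and $p$ there is a constant $m(d,p)$, independent of $n$, $S$ and $W$, which equals the maximum number of vertices of ${\rm conv}(WS)={\rm conv}\{Wx: x\in S\}$ over all $n$, all matroids $S\subset\{0,1\}^n$, and all $\{0,1,\dots,p\}$-valued $d\times n$ matrices $W$. Moreover, if $S$ is presented by an independence oracle, then $\max\{f(Wx): x\in S\}$ can be solved for any convex $f:\mathbb{R}^d\to\mathbb{R}$ (presented by a comparison oracle) by greedily solving $m(d,p)$ linear optimization problems $\max\{wx : x\in S\}$, and in polynomial time.
   Context: A set $S\subset\{0,1\}^n$ is called a matroid if it is the set of indicator vectors of the bases of a matroid on the ground set $\{1,\dots,n\}$. An independence oracle for $S$ is one that, queried on $x\in\{0,1\}^n$, asserts whether or not ${\rm supp}(x)\subseteq{\rm supp}(z)$ for some $z\in S$. A comparison oracle for $f$ is one that, queried on $y,z\in\mathbb{R}^d$, asserts whether or not $f(y)<f(z)$. *)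

(* Defs.v *)
From HB Require Import structures.
From mathcomp Require Import all_boot all_order all_algebra.
From mathcomp Require Import boolp classical_sets cardinality reals convex.
Set Implicit Arguments.
Unset Strict Implicit.
Unset Printing Implicit Defensive.
Import Order.TTheory GRing.Theory Num.Theory.
Local Open Scope ring_scope.

Notation vec01 n := {ffun 'I_n -> bool}.

Definition supp n (x : vec01 n) : {set 'I_n} := [set j | x j].

Definition indicator n (B : {set 'I_n}) : vec01 n := [ffun j => j \in B].

(* [I] is the family of independent sets of a matroid on ['I_n]. *)
Definition independence_family n (I : {set {set 'I_n}}) : Prop :=
  [/\ finset.set0 \in I,
      forall A B : {set 'I_n}, A \subset B -> B \in I -> A \in I &
      forall A B : {set 'I_n}, A \in I -> B \in I -> (#|A| < #|B|)%N ->
        exists2 j, j \in B :\: A & j |: A \in I].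

Definition bases n (I : {set {set 'I_n}}) : {set {set 'I_n}} :=
  [set B : {set 'I_n} | maxset [in I] B].

Definition is_matroid n (S : {set vec01 n}) : Prop :=
  exists2 I : {set {set 'I_n}}, independence_family I &
    S = [set indicator B | B in bases I].

Definition independent n (S : {set vec01 n}) (x : vec01 n) : bool :=
  [exists z in S, supp x \subset supp z].

Definition image_vec (R : realType) d p n (W : 'M['I_p.+1]_(d, n))
    (x : vec01 n) : 'cV[R]_d :=
  map_mx (fun a : 'I_p.+1 => (a : nat)%:R) W *m \col_j (x j)%:R.

Definition image_set (R : realType) d p n (W : 'M['I_p.+1]_(d, n))
    (S : {set vec01 n}) : set 'cV[R]_d :=
  (fun y => exists2 x, x \in S & y = image_vec R W x).
Arguments image_set R {d p n} W S _.

Definition conv_hull (R : realType) d (A : set 'cV[R]_d) : set 'cV[R]_d :=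
  smallest (@convex_set R 'cV[R]_d) A.

(* A vertex is a zero-dimensional face: the unique maximizer over [P] of some
   linear functional. *)
Definition vertices (R : realType) d (P : set 'cV[R]_d) : set 'cV[R]_d :=
  (fun v => P v /\
     exists h : 'rV[R]_d, forall u, P u -> u != v -> (h *m u) 0 0 < (h *m v) 0 0).

(* A RAM with integer variables and integer arrays.  There is deliberately no
   multiplication: with addition and subtraction only, one step increases
   bit-lengths by at most a constant depending on the program, so counting
   steps is polynomially equivalent to Turing machine time.  The set S and the
   function f are accessible only through [CIndep] and [CComp]. *)

Inductive expr : Type :=
| EConst of int
| EVar of nat
| EGet of nat & expr
| EAdd of expr & expr
| ESub of expr & expr.

Inductive cmd : Type :=
| CSkip
| CSet of nat & expr               (* variable := expression *)
| CPut of nat & expr & expr        (* array[expression] := expression *)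
| CSeq of cmd & cmd
| CIf of expr & expr & cmd & cmd   (* branch on e1 < e2 *)
| CWhile of expr & expr & cmd      (* loop while e1 < e2 *)
| CObjective of nat                (* declare an objective; see [Objective] *)
| CIndep of nat & nat              (* variable := independence oracle(array) *)
| CComp of nat & nat & nat.        (* variable := comparison oracle(arrays) *)

Record store : Type := Store { var : nat -> int ; arr : nat -> int -> int }.

Definition upd (K : eqType) (A : Type) (g : K -> A) (k : K) (a : A) : K -> A :=
  fun k' => if k' == k then a else g k'.

Definition set_var (s : store) (v : nat) (z : int) : store :=
  Store (upd (var s) v z) (arr s).

Definition set_arr (s : store) (a : nat) (k z : int) : store :=
  Store (var s) (upd (arr s) a (upd (arr s a) k z)).

Fixpoint eval (s : store) (e : expr) : int :=
  match e with
  | EConst z => z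
  | EVar v => var s v
  | EGet a e => arr s a (eval s e)
  | EAdd e1 e2 => eval s e1 + eval s e2
  | ESub e1 e2 => eval s e1 - eval s e2
  end.

Fixpoint esize (e : expr) : nat :=
  match e with
  | EConst _ | EVar _ => 1
  | EGet _ e => (esize e).+1
  | EAdd e1 e2 | ESub e1 e2 => (esize e1 + esize e2).+1
  end.

Definition read_bits n (s : store) (a : nat) : vec01 n :=
  [ffun j : 'I_n => arr s a (j : nat)%:Z != 0].

Definition read_weights n (s : store) (a : nat) : {ffun 'I_n -> int} :=
  [ffun j : 'I_n => arr s a (j : nat)%:Z].

Definition read_point d (s : store) (a : nat) : 'cV[int]_d :=
  \col_(i < d) arr s a (i : nat)%:Z.

(* [Objective w] leaves the store unchanged; it records that the program starts
   solving the linear optimization problem with objective [w]. *)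
Inductive event n : Type :=
| Objective of {ffun 'I_n -> int}
| Query of vec01 n.

(* [exec indep comp c s s' t l]: started in store [s], the program [c] halts in
   store [s'] after time [t], producing the log [l].  An expression costs its
   size and an oracle call the size of its query. *)
Inductive exec n d (indep : vec01 n -> bool)
    (comp : 'cV[int]_d -> 'cV[int]_d -> bool) :
  cmd -> store -> store -> nat -> seq (event n) -> Prop :=
| exec_skip s : exec indep comp CSkip s s 1 [::]
| exec_set v e s :
    exec indep comp (CSet v e) s (set_var s v (eval s e)) (esize e).+1 [::]
| exec_put a e1 e2 s :
    exec indep comp (CPut a e1 e2) s (set_arr s a (eval s e1) (eval s e2))
      (esize e1 + esize e2).+1 [::]
| exec_seq c1 c2 s s1 s2 t1 t2 l1 l2 :
    exec indep comp c1 s s1 t1 l1 -> exec indep comp c2 s1 s2 t2 l2 ->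
    exec indep comp (CSeq c1 c2) s s2 (t1 + t2)%N (l1 ++ l2)
| exec_if e1 e2 c1 c2 s s1 t l :
    exec indep comp (if eval s e1 < eval s e2 then c1 else c2) s s1 t l ->
    exec indep comp (CIf e1 e2 c1 c2) s s1 (esize e1 + esize e2 + t).+1 l
| exec_while_end e1 e2 c s :
    (eval s e1 < eval s e2) = false ->
    exec indep comp (CWhile e1 e2 c) s s (esize e1 + esize e2).+1 [::]
| exec_while_step e1 e2 c s s1 s2 t1 t2 l1 l2 :
    (eval s e1 < eval s e2) = true ->
    exec indep comp c s s1 t1 l1 ->
    exec indep comp (CWhile e1 e2 c) s1 s2 t2 l2 ->
    exec indep comp (CWhile e1 e2 c) s s2
      (esize e1 + esize e2 + t1 + t2).+1 (l1 ++ l2)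
| exec_objective a s :
    exec indep comp (CObjective a) s s n.+1 [:: Objective (read_weights n s a)]
| exec_indep v a s :
    exec indep comp (CIndep v a) s
      (set_var s v (indep (read_bits n s a) : nat)%:Z)
      n.+1 [:: Query (read_bits n s a)]
| exec_comp v a b s :
    exec indep comp (CComp v a b) s
      (set_var s v (comp (read_point d s a) (read_point d s b) : nat)%:Z)
      (d + d).+1 [::].

(* The conventions for input and output: variable 0 holds [n], entry
   [j * d + i] of array 0 holds [W i j], everything else is 0; the output is
   read from array 1. *)
Definition input d p n (W : 'M['I_p.+1]_(d, n)) : store :=
  Store
    (fun v => if v is 0%N then n%:Z else 0)
    (fun a k => match a, k with
       | 0%N, Posz k =>
           if (insub (k %% d)%N, insub (k %/ d)%N) is (Some i, Some j)
           then (W i j : nat)%:Z else 0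
       | _, _ => 0
       end).

Definition output n (s : store) : vec01 n := read_bits n s 1.

(* Only integer points of R^d can be submitted by a program. *)
Definition comparison (R : realType) d (f : 'cV[R]_d -> R)
    (y z : 'cV[int]_d) : bool :=
  f (map_mx intr y) < f (map_mx intr z).

Definition add_elt n (x : vec01 n) (j : 'I_n) : vec01 n :=
  [ffun i => (i == j) || x i].

Fixpoint greedy_from n (indep : vec01 n -> bool) (x : vec01 n)
    (order : seq 'I_n) : vec01 n :=
  if order is j :: order' then
    let y := add_elt x j in
    greedy_from indep (if indep y then y else x) order'
  else x.

Fixpoint greedy_queries n (indep : vec01 n -> bool) (x : vec01 n)
    (order : seq 'I_n) : seq (vec01 n) :=
  if order is j :: order' then
    let y := add_elt x j in
    y :: greedy_queries indep (if indep y then y else x) order'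
  else [::].

Definition zero_vec n : vec01 n := [ffun=> false].

(* [l] is the log of a run of the greedy algorithm on [max {w x : x in S}]
   (ties being broken arbitrarily), and [x] is what that run returns. *)
Definition greedy_run n (indep : vec01 n -> bool) (w : {ffun 'I_n -> int})
    (x : vec01 n) (l : seq (event n)) : Prop :=
  exists order : seq 'I_n,
    [/\ perm_eq order (enum 'I_n),
        sorted (fun i j => w j <= w i) order,
        x = greedy_from indep (zero_vec n) order &
        l = Objective w
              :: [seq Query q | q <- greedy_queries indep (zero_vec n) order]].

Definition linear_value n (w : {ffun 'I_n -> int}) (x : vec01 n) : int :=
  \sum_j w j * (x j)%:R.

Definition is_maximizer n (T : Type) (le : T -> T -> bool) (S : {set vec01 n})
    (g : vec01 n -> T) (x : vec01 n) : Prop :=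
  x \in S /\ forall z, z \in S -> le (g z) (g x).

(* [P] solves [max {f (W x) : x in S}] in time [bound], by solving greedily
   exactly [m] linear optimization problems over [S] and returning one of the
   [m] solutions found. *)
Definition solves_by_greedy (R : realType) d p n (P : cmd) (m bound : nat)
    (W : 'M['I_p.+1]_(d, n)) (S : {set vec01 n}) (f : 'cV[R]_d -> R) : Prop :=
  exists (s : store) (t : nat) (l : seq (event n))
         (w : 'I_m -> {ffun 'I_n -> int}) (x : 'I_m -> vec01 n)
         (lg : 'I_m -> seq (event n)),
    [/\ exec (independent S) (comparison f) P (input W) s t l,
        (t <= bound)%N,
        is_maximizer <=%R S (fun z => f (image_vec R W z)) (output n s),
        l = flatten [seq lg k | k <- enum 'I_m] &
        (forall k, greedy_run (independent S) (w k) (x k) (lg k) /\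
                   is_maximizer <=%R S (linear_value (w k)) (x k))
        /\ exists k, output n s = x k].

(* Main.v *)
(* Two bases of a matroid are connected by exchanges, so the order in which
   greedy maximizes [h W] over [S] depends only on the order that [h] induces on
   the columns, i.e. on the chamber of [h] in the arrangement of the hyperplanes
   [h a = h b] with [a], [b] in {0,...,p}^d.  Hence the greedy solutions for one
   integer functional per chamber maximize every linear functional, which yields
   all vertices and, by Gordan's alternative, a maximizer of every convex
   function; so [m(d,p)] is at most the number of chambers.  The bound is
   attained by a partition matroid whose image is the zonotope generated by all
   differences [a - b].  The weights [h W] lie in a finite set that does not
   depend on [n], so the algorithm needs no sorting: it scans the columns once
   for each possible weight, in decreasing order. *)

Require Import Defs.
From mathcomp Require Import all_boot all_order all_algebra.
From mathcomp Require Import boolp classical_sets cardinality reals convex.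
From mathcomp Require Import zify ring lra interval_inference.
Set Implicit Arguments.
Unset Strict Implicit.
Unset Printing Implicit Defensive.
Import Order.TTheory GRing.Theory Num.Theory.
Local Open Scope ring_scope.

(** * Greedy on matroids *)

Section Matroid.
Import boot.fintype boot.finset.

Lemma supp_indicator n (B : {set 'I_n}) : supp (indicator B) = B.
Proof. by apply/setP => j; rewrite inE ffunE. Qed.

Lemma indicator_supp n (x : vec01 n) : indicator (supp x) = x.
Proof. by apply/ffunP => j; rewrite ffunE inE. Qed.

Lemma supp_add_elt n (x : vec01 n) j : supp (add_elt x j) = j |: supp x.
Proof. by apply/setP => i; rewrite !inE ffunE. Qed.

Lemma supp_zero_vec n : supp (zero_vec n) = set0.
Proof. by apply/setP => i; rewrite !inE ffunE. Qed.

Section Independence.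
Variables (n : nat) (I : {set {set 'I_n}}).
Hypothesis indI : independence_family I.
Implicit Types A B X Y Z : {set 'I_n}.

Lemma independent_sub A B : A \subset B -> B \in I -> A \in I.
Proof. by case: indI => _ + _; apply. Qed.

Lemma basisP B :
  reflect (B \in I /\ forall A, A \in I -> B \subset A -> A = B)
    (B \in bases I).
Proof.
by rewrite inE; apply: (iffP maxsetP).
Qed.

Lemma leq_card_basis A B : A \in I -> B \in bases I -> (#|A| <= #|B|)%N.
Proof.
move=> AI /basisP[BI maxB]; rewrite leqNgt; apply/negP => ltBA.
have [_ _ /(_ B A BI AI ltBA)[j]] := indI.
rewrite !inE => /andP[jB _] /maxB/(_ (subsetUr _ _)) jBB.
by move: jB; rewrite -jBB !inE eqxx.
Qed.

Lemma card_basis A B : A \in I -> B \in bases I -> #|B| = #|A| ->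
  A \in bases I.
Proof.
move=> AI BI eqBA; apply/basisP; split=> // X XI AX; apply/eqP.
by rewrite eq_sym eqEcard AX -eqBA leq_card_basis.
Qed.

(** A maximal independent set between [j |: X] and [j |: Z] has the size of [Z], so it arises from
    [j |: Z] by dropping one element, which lies outside [X] and differs from [j]. *)
Lemma basis_exchange X Z j : Z \in bases I -> X \subset Z -> j \notin Z ->
    j |: X \in I ->
  exists2 i, i \in Z :\: X & j |: (Z :\ i) \in bases I.
Proof.
move=> ZB XZ jZ jXI; have /basisP[ZI maxZ] := ZB.
have [A /maxsetP[/and3P[AI jXA AjZ] maxA] _] :=
  @maxset_exists _ (fun A => [&& A \in I, j |: X \subset A & A \subset j |: Z])
    (j |: X) (introT and3P (And3 jXI (subxx _) (setUS [set j] XZ))).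
have jA : j \in A by apply: (subsetP jXA); rewrite setU11.
have cardA : #|A| = #|Z|.
  (* If [A] were smaller than [Z], augmenting it from [Z] would stay inside [j |: Z] and contradict
     its maximality. *)
  apply/eqP; rewrite eqn_leq leq_card_basis//= leqNgt; apply/negP => ltAZ.
  have [_ _ /(_ A Z AI ZI ltAZ)[i]] := indI.
  rewrite !inE => /andP[iA iZ] iAI.
  have iAA : i |: A = A.
    apply: maxA; last exact: subsetUr.
    rewrite iAI (subset_trans jXA (subsetUr _ _))/= subUset AjZ.
    by rewrite sub1set !inE iZ orbT.
  by move: iA; rewrite -iAA setU11.
have /cards1P[i ijZA] : #|(j |: Z) :\: A| == 1%N.
  have := cardsID A (j |: Z); rewrite cardsU1 jZ (setIidPr AjZ) cardA.
  by move=> /eqP; rewrite addnC eqn_add2r.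
have : i \in (j |: Z) :\: A by rewrite ijZA set11.
rewrite !inE => /andP[iA /orP[/eqP ij|iZ]]; first by rewrite ij jA in iA.
exists i.
  rewrite !inE iZ andbT; apply: contra iA => iX.
  by apply: (subsetP jXA); rewrite !inE iX orbT.
suff -> : j |: (Z :\ i) = A by apply: card_basis ZB _ => //.
apply/setP => k; rewrite !inE.
have := erefl (k \in (j |: Z) :\: A); rewrite {1}ijZA !inE.
have [->|kj/=] := eqVneq k j; first by rewrite jA.
have [->|ki/=] := eqVneq k i; first by rewrite (negPf iA).
move=> /esym/negbT; rewrite negb_and negbK => /orP[kA|kZ].
  by rewrite kA; have := subsetP AjZ _ kA; rewrite !inE (negPf kj).
rewrite (negPf kZ); apply/esym/negbTE; apply: contra kZ => kA.
by have := subsetP AjZ _ kA; rewrite !inE (negPf kj).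
Qed.

(** Every independent set extends to a maximal one, so the oracle defined through bases recovers the
    family [I]. *)
Lemma independentE x :
  independent [set indicator B | B in bases I] x = (supp x \in I).
Proof.
apply/existsP/idP => [[z /andP[/imsetP[B BB ->] xB]]|xI].
  rewrite supp_indicator in xB.
  by have /basisP[BI _] := BB; apply: independent_sub BI.
have [B maxB xB] := @maxset_exists _ [in I] _ xI.
exists (indicator B); rewrite supp_indicator xB andbT imset_f//.
by rewrite inE.
Qed.

Variable (K : realDomainType) (w : 'I_n -> K).

(* Every basis lying between the current set and the union of the current set
   with the remaining elements is matched by the output: when [j] is accepted
   but not in that basis, it is exchanged for a remaining, hence no heavier,
   element. *)
Lemma greedy_from_optimal (S := [set indicator B | B in bases I])
    (order : seq 'I_n) (x : vec01 n) Z :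
    sorted (fun i j => w j <= w i) order ->
    Z \in bases I -> supp x \subset Z ->
    {subset Z <= [predU supp x & order]} ->
  let G := supp (greedy_from (independent S) x order) in
  G \in bases I /\ \sum_(j in Z) w j <= \sum_(j in G) w j.
Proof.
elim: order x Z => [|j order IH] x Z /= so ZB xZ Zx.
  suff -> : supp x = Z by [].
  apply/eqP; rewrite eqEsubset xZ; apply/subsetP => i /Zx.
  by rewrite inE/= orbF.
have so' := path_sorted so.
have le_wj i : i \in order -> w i <= w j.
  have tr : transitive (fun i j => w j <= w i).
    by move=> a b c ba ca; apply: le_trans ba.
  by move: (order_path_min tr so) => /allP; apply.
have [_ maxZ] := basisP _ ZB.
rewrite independentE supp_add_elt; case: ifPn => [jI|jI].
  have [jZ|jZ] := boolP (j \in Z).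
    apply: IH => //; first by rewrite supp_add_elt subUset sub1set jZ.
    move=> i /Zx; rewrite supp_add_elt !inE => /orP[->|/orP[->|->]];
    by rewrite ?orbT.
  have [i] := basis_exchange ZB xZ jZ jI.
  rewrite in_setD inE => /andP[ix iZ] Z'B.
  have io : i \in order.
    have := Zx _ iZ; rewrite !inE.
    have -> : (i == j) = false by apply/negP => /eqP ij; rewrite -ij iZ in jZ.
    by rewrite (negPf ix).
  have [||GB le] := IH (add_elt x j) (j |: (Z :\ i)) so' Z'B.
  - rewrite supp_add_elt setUS//.
    apply/subsetP => k kx; rewrite in_setD1 (subsetP xZ)//.
    by rewrite andbT; apply: contraTneq kx => ->; rewrite inE.
  - move=> k; rewrite supp_add_elt !inE => /orP[->//|/andP[_ /Zx]].
    by rewrite !inE => /orP[->|/orP[->|->]]; rewrite ?orbT.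
  split=> //; apply: le_trans le.
  rewrite (bigD1 i)//= big_setU1/=; last by rewrite !inE (negPf jZ) andbF.
  rewrite lerD ?le_wj//.
  by under eq_bigl do rewrite andbC; rewrite (eq_bigl (mem (Z :\ i)))//= => k;
    rewrite !inE.
(* A rejected [j] is not in [Z]: otherwise [j |: supp x] would be a subset of the independent set
   [Z]. *)
apply: IH => // k kZ; have := Zx _ kZ; rewrite !inE => /orP[->//|/orP[/eqP kj|->]];
  last by rewrite orbT.
case/negP: jI; rewrite -kj; apply: independent_sub (proj1 (basisP _ ZB)).
by rewrite subUset sub1set kZ.
Qed.

End Independence.

Lemma sum_supp n (K : nzRingType) (w : 'I_n -> K) (x : vec01 n) :
  \sum_j w j * (x j)%:R = \sum_(j in supp x) w j.
Proof.
rewrite [RHS]big_mkcond; apply: eq_bigr => j _; rewrite inE.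
by case: (x j); rewrite ?mulr1 ?mulr0.
Qed.

(** The output depends on the order alone, so it is optimal for every weighting for which that order
    is sorted. [K] is kept general because one order serves both the integer weights of a run and
    real functionals. *)
Lemma greedy_optimal n (S : {set vec01 n}) (K : realDomainType)
    (w : 'I_n -> K) (order : seq 'I_n) :
    is_matroid S -> perm_eq order (enum 'I_n) ->
    sorted (fun i j => w j <= w i) order ->
  is_maximizer <=%R S (fun x => \sum_j w j * (x j)%:R)
    (greedy_from (independent S) (zero_vec n) order).
Proof.
move=> [I indI ->] oP so; set S' := [set _ | _ in _].
have H Z (ZB : Z \in bases I) := greedy_from_optimal indI (x := zero_vec n) so ZB.
have sub0 (Z : {set _}) : supp (zero_vec n) \subset Z by rewrite supp_zero_vec sub0set.
have subo (Z : {set 'I_n}) : {subset Z <= [predU supp (zero_vec n) & order]}.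
  by move=> i _; rewrite !inE (perm_mem oP) mem_enum orbT.
split.
  have [I0 _ _] := indI.
  have [Z maxZ _] := @maxset_exists _ [in I] _ I0.
  have ZB : Z \in bases I by rewrite inE.
  have [GB _] := H Z ZB (sub0 Z) (subo Z).
  by apply/imsetP; exists (supp (greedy_from (independent S') (zero_vec n) order)) => //; rewrite indicator_supp.
move=> z /imsetP[B BB ->]; rewrite !sum_supp supp_indicator.
by have [] := H B BB (sub0 B) (subo B).
Qed.

End Matroid.

(** * Convexity *)

Lemma convex_setP (R : numDomainType) (V : lmodType R) (A : set V) :
  @convex_set R V A <->
  forall x y (t : R), 0 <= t -> t <= 1 -> A x -> A y ->
    A (t *: x + (1 - t) *: y).
Proof.
split=> [cA x y t t0 t1 Ax Ay|cA x y t /set_mem Ax /set_mem Ay].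
  by have /set_mem := cA x y (Itv01 t0 t1) (mem_set Ax) (mem_set Ay).
by apply/mem_set; apply: cA.
Qed.

Lemma convex_sublevel (R : numFieldType) (V : lmodType R) (f : V -> R) (M : R) :
  @convex_function R V setT f -> @convex_set R V (fun x => f x <= M).
Proof.
move=> cf; apply/convex_setP => x y t t0 t1 fx fy.
apply: le_trans (cf (Itv01 t0 t1) x y (in_setT _) (in_setT _)) _ => /=.
rewrite (_ : M = t * M + (1 - t) * M); last by ring.
by rewrite lerD// ler_wpM2l// subr_ge0.
Qed.

(** Back-substitution in Fourier-Motzkin elimination: this chooses the eliminated coordinate between
    its lower and upper bounds. Either list may be empty. *)
Lemma seq_separation (R : realFieldType) (L U : seq R) :
  (forall l u, l \in L -> u \in U -> l < u) ->
  exists t, (forall l, l \in L -> l < t) /\ (forall u, u \in U -> t < u).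
Proof.
elim: U => [_|u U IHU LU].
  elim: L => [|l L [t [Lt _]]]; first by exists 0.
  exists (Num.max t (l + 1)); split=> // k.
  rewrite inE lt_max => /orP[/eqP->|/Lt->//].
  by rewrite ltrDl ltr01 orbT.
have [|t [Lt tU]] := IHU.
  by move=> l v lL vU; apply: LU => //; rewrite inE vU orbT.
have [tu|ut] := ltP t u.
  by exists t; split=> // v; rewrite inE => /orP[/eqP->|/tU].
have {}LU l : l \in L -> l < u by move=> lL; apply: LU; rewrite ?mem_head.
(* Here [u <= t], so any value between [L] and [u] is also below the remaining upper bounds. *)
suff [v [Lv vu]] : exists v, (forall l, l \in L -> l < v) /\ v < u.
  exists v; split=> // x; rewrite inE => /orP[/eqP->//|/tU tx].
  exact: lt_trans vu (le_lt_trans ut tx).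
elim: L LU {IHU Lt} => [_|l L IHL lLu].
  by exists (u - 1); split=> //; rewrite ltrBlDr ltrDl.
have [|v [Lv vu]] := IHL.
  by move=> k kL; apply: lLu; rewrite inE kL orbT.
have lu := lLu l (mem_head _ _).
exists (Num.max v ((l + u) / 2)); split; last by rewrite gt_max vu midf_lt.
move=> k; rewrite inE lt_max => /orP[/eqP->|/Lv->//].
by rewrite midf_lt ?orbT.
Qed.

(* Gordan's alternative, by Fourier-Motzkin elimination of the first
   coordinate; membership of 0 in the convex hull is expressed by the convex
   sets containing the vectors. *)
Lemma gordan_alternative (R : realFieldType) d (s : seq 'cV[R]_d) :
  (exists h : 'rV[R]_d, forall v, v \in s -> 0 < (h *m v) 0 0) \/
  (forall C : set 'cV[R]_d, @convex_set R 'cV[R]_d C ->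
     (forall v, v \in s -> C v) -> C 0).
Proof.
elim: d => [|d IH] in s *.
  case: s => [|v s]; first by left; exists 0.
  by right=> C _ /(_ v (mem_head _ _)); rewrite [v]flatmx0.
pose hd (v : 'cV[R]_(1 + d)) : R := usubmx v 0 0.
pose tl (v : 'cV[R]_(1 + d)) : 'cV[R]_d := dsubmx v.
have vE (v : 'cV[R]_(1 + d)) : v = col_mx (hd v)%:M (tl v).
  by rewrite -[LHS]vsubmxK [usubmx v]mx11_scalar.
(* [coef p n] is the weight for which the convex combination of [p] and [n] has first coordinate 0;
   [comb p n] is the rest of that combination. *)
pose coef p n := - hd n / (hd p - hd n).
pose comb p n := coef p n *: tl p + (1 - coef p n) *: tl n.
pose P := [seq v <- s | 0 < hd v].
pose Q := [seq v <- s | hd v < 0].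
pose Z := [seq v <- s | hd v == 0].
have [[h hP]|hC] := IH ([seq tl v | v <- Z] ++ [seq comb p n | p <- P, n <- Q]).
  left; pose al v := (h *m tl v) 0 0.
  (* The first coordinate [t] must make [t * hd v + al v] positive: a lower bound on [t] if [hd v]
     is positive, an upper bound if it is negative. Positivity of [h] on the combinations makes
     these bounds compatible. *)
  have [|t [Pt tQ]] := @seq_separation R [seq - al p / hd p | p <- P]
                         [seq al n / - hd n | n <- Q].
    move=> _ _ /mapP[p pP ->] /mapP[n nQ ->].
    have : p \in P by []. have : n \in Q by [].
    rewrite !mem_filter => /andP[n0 _] /andP[p0 _].
    have := hP (comb p n); rewrite mem_cat allpairs_f ?orbT// => /(_ isT).
    have -> : (h *m comb p n) 0 0 = coef p n * al p + (1 - coef p n) * al n.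
      by rewrite mulmxDr -!scalemxAr mxE [X in X + _]mxE [X in _ + X]mxE.
    have pn0 : 0 < hd p - hd n by rewrite subr_gt0 (lt_trans n0).
    rewrite (_ : coef p n * _ + _ = (- hd n * al p + hd p * al n) / (hd p - hd n)); last first.
      by rewrite /coef; field; rewrite gt_eqF.
    rewrite pmulr_lgt0 ?invr_gt0// => gt0.
    rewrite ltr_pdivrMr// mulrAC ltr_pdivlMr ?oppr_gt0//.
    by move: gt0; lra.
  pose th : 'rV[R]_(1 + d) := row_mx t%:M h.
  have thE (v : 'cV[R]_(1 + d)) : (th *m v) 0 0 = t * hd v + al v.
    rewrite {1}[v]vE mul_row_col -scalar_mxM mxE [X in X + _]mxE.
    by rewrite eqxx mulr1n.
  exists th => v vs; rewrite thE; have [v0|v0|v0] := ltgtP (hd v) 0.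
  - have /tQ : al v / - hd v \in [seq al n / - hd n | n <- Q].
      by apply: map_f; rewrite mem_filter v0.
    by rewrite ltr_pdivlMr ?oppr_gt0//; lra.
  - have /Pt : - al v / hd v \in [seq - al p / hd p | p <- P].
      by apply: map_f; rewrite mem_filter v0.
    by rewrite ltr_pdivrMr//; lra.
  - rewrite v0 mulr0 add0r; apply: hP; rewrite mem_cat map_f//.
    by rewrite mem_filter v0 eqxx.
right=> C /convex_setP cC sC.
have {}cC (x y : 'cV[R]_(1 + d)) (t : R) :
    0 <= t -> t <= 1 -> C x -> C y -> C (t *: x + (1 - t) *: y).
  exact: cC.
have z0 : 0 = col_mx (0 : 'cV[R]_1) (0 : 'cV[R]_d) by rewrite col_mx0.
suff : C (col_mx (0 : 'cV[R]_1) (0 : 'cV[R]_d)) by rewrite -z0.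
(* The slice of [C] at first coordinate 0 is convex and contains the reduced vectors, so the
   induction hypothesis puts 0 in it. *)
apply: (hC (fun u => C (col_mx (0 : 'cV[R]_1) u))).
  apply/convex_setP => x y t t0 t1 Cx Cy.
  have := cC _ _ _ t0 t1 Cx Cy.
  by rewrite !scale_col_mx add_col_mx !scaler0 addr0.
move=> v; rewrite mem_cat => /orP[/mapP[u]|/allpairsP[[p n]/= []]].
  rewrite mem_filter => /andP[/eqP u0 us] ->.
  have := sC u us; rewrite [u in C u]vE u0 (_ : 0%:M = 0)//.
  exact: raddf0.
rewrite !mem_filter => /andP[p0 ps] /andP[n0 ns] ->.
have pn0 : 0 < hd p - hd n by rewrite subr_gt0 (lt_trans n0).
have c0 : 0 <= coef p n by rewrite divr_ge0 ?oppr_ge0 ?ltW.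
have c1 : coef p n <= 1 by rewrite ler_pdivrMr// mul1r lerDr ltW.
have := cC _ _ _ c0 c1 (sC p ps) (sC n ns).
rewrite [X in _ *: X + _]vE [X in _ + _ *: X]vE !scale_col_mx add_col_mx.
rewrite !scale_scalar_mx -raddfD/= (_ : coef p n * hd p + _ = 0) ?raddf0//.
by rewrite /coef; field; rewrite gt_eqF.
Qed.

(** Gordan's alternative is applied to the differences [y - v l]. A functional positive on all of
    them contradicts the hypothesis; otherwise 0 lies in every convex set containing them, in
    particular in a reflected sublevel set of [f]. *)
Lemma convex_function_max (R : realType) d m (f : 'cV[R]_d -> R)
    (y : 'cV[R]_d) (v : 'I_m -> 'cV[R]_d) :
    convex_function setT f ->
    (forall h : 'rV[R]_d, exists k, (h *m y) 0 0 <= (h *m v k) 0 0) ->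
  exists k, f y <= f (v k).
Proof.
(* The functional 0 supplies an index, so that the maximum of [f] over the points [v l] exists. *)
move=> cf hv; have [k0 _] := hv 0.
have [k leM] : exists k, forall l, f (v l) <= f (v k).
  by exists [arg max_(k > k0) f (v k)]%O; case: arg_maxP => // i _ le l; apply: le.
exists k; have [[h hP]|hC] := gordan_alternative [seq y - v l | l <- enum 'I_m].
  have [l] := hv h; rewrite leNgt => /negP[].
  have := hP (y - v l); rewrite (map_f (fun i => y - v i)) ?mem_enum// => /(_ isT).
  by rewrite mulmxBr [X in 0 < X -> _]mxE [X in _ + X]mxE subr_gt0.
(* This set contains each [y - v l] since [f (v l) <= f (v k)]; that it contains 0 is the claim. *)
have := hC (fun u => f (y - u) <= f (v k)).
rewrite subr0; apply; last by move=> _ /mapP[l _ ->]; rewrite subKr.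
have /convex_setP cM := convex_sublevel (M := f (v k)) cf.
apply/convex_setP => a b t t0 t1 fa fb.
have := cM _ _ _ t0 t1 fa fb.
by rewrite !scalerBr addrACA -scalerDl subrKC scale1r -opprD.
Qed.

(** * Chambers and vertices *)

Lemma convex_halfspace (R : numFieldType) d (h : 'rV[R]_d) (c : R) :
  @convex_set R 'cV[R]_d (fun u => (h *m u) 0 0 <= c).
Proof.
apply/convex_setP => x y t t0 t1 hx hy.
rewrite mulmxDr -!scalemxAr mxE [X in X + _]mxE [X in _ + X]mxE.
rewrite (_ : c = t * c + (1 - t) * c); last by ring.
by rewrite lerD// ler_wpM2l// subr_ge0.
Qed.

(** Unique maximality passes from [A] to its hull because the points that equal [v] or lie strictly
    below it along [h] form a convex set. *)
Lemma vertices_conv_hull (R : realType) d (A : set 'cV[R]_d) v (h : 'rV[R]_d) :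
    A v -> (forall u, A u -> u != v -> (h *m u) 0 0 < (h *m v) 0 0) ->
  vertices (conv_hull A) v.
Proof.
move=> Av hA; split; first by move=> C /= [_]; apply.
exists h; suff : (conv_hull A `<=` (fun u => u != v -> (h *m u) 0 0 < (h *m v) 0 0))%classic.
  by [].
apply: smallest_sub => //; apply/convex_setP => x y t t0 t1 hx hy.
have [->|xv] := eqVneq x v.
  have [->|yv] := eqVneq y v; first by rewrite -scalerDl subrKC scale1r eqxx.
  have [->|t_neq1] := eqVneq t 1; first by rewrite subrr scale1r scale0r addr0 eqxx.
  have s_gt0 : 0 < 1 - t by rewrite subr_gt0 lt_neqAle t_neq1.
  move=> _; rewrite mulmxDr -!scalemxAr mxE [X in X + _]mxE [X in _ + X]mxE.
  by have := hy yv; rewrite -(ltr_pM2l s_gt0); lra.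
have [->|t_neq0] := eqVneq t 0.
  by rewrite scale0r add0r subr0 scale1r; exact: hy.
move=> _; rewrite mulmxDr -!scalemxAr mxE [X in X + _]mxE [X in _ + X]mxE.
have t_gt0 : 0 < t by rewrite lt_neqAle eq_sym t_neq0.
have := hx xv; rewrite -(ltr_pM2l t_gt0) => ltx.
suff : (1 - t) * (h *m y) 0 0 <= (1 - t) * (h *m v) 0 0 by lra.
rewrite ler_wpM2l ?subr_ge0//.
by have [->//|/hy/ltW] := eqVneq y v.
Qed.

Notation column d p := 'cV['I_p.+1]_d.

Definition colval (K : nzRingType) d p (h : 'rV[K]_d) (c : column d p) : K :=
  \sum_i h 0 i * (c i 0 : nat)%:R.

Lemma colval_intr (R : realType) d p (h : 'rV[int]_d) (c : column d p) :
  colval (map_mx intr h) c = (colval h c)%:~R :> R.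
Proof.
by rewrite /colval rmorph_sum; apply: eq_bigr => i _; rewrite rmorphM mxE rmorph_nat.
Qed.

Lemma mul_image_vec (R : realType) d p n (W : 'M['I_p.+1]_(d, n))
    (h : 'rV[R]_d) (x : vec01 n) :
  (h *m image_vec R W x) 0 0 = \sum_j colval h (col j W) * (x j)%:R.
Proof.
rewrite mulmxA mxE; apply: eq_bigr => j _; rewrite !mxE; congr (_ * _).
by apply: eq_bigr => i _; rewrite !mxE.
Qed.

Definition pattern (K : realDomainType) d p (h : 'rV[K]_d) :
    {set column d p * column d p} :=
  [set ab | colval h ab.1 < colval h ab.2].

(* The chambers of the arrangement of the hyperplanes [h a = h b] for distinct
   columns [a] and [b], each given by the order it induces on the columns. *)
Definition chambers d p : {set {set column d p * column d p}} :=
  [set s | `[< exists2 h : 'rV[int]_d,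
                 injective (colval (p := p) h) & s = pattern p h >]].

(** One integer functional is chosen per chamber. That every chamber is reached gives the upper
    bound and the algorithm; that the patterns are distinct gives the lower bound. *)
Lemma chamber_representatives d p :
  exists hs : 'I_#|chambers d p| -> 'rV[int]_d,
    [/\ forall k, injective (colval (p := p) (hs k)),
        injective (fun k => pattern p (hs k)) &
        forall h : 'rV[int]_d, injective (colval (p := p) h) ->
          exists k, pattern p (hs k) = pattern p h].
Proof.
have /choice[hs hsP] (k : 'I_#|chambers d p|) : exists h : 'rV[int]_d,
    injective (colval (p := p) h) /\ enum_val k = pattern p h.
  by have := enum_valP k; rewrite inE => /asboolP[h]; exists h.
exists hs; split=> [k|k l|h gh]; first by case: (hsP k).
  by case: (hsP k) (hsP l) => _ <- [_ <-]; apply: enum_val_inj.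
have hch : pattern p h \in chambers d p by rewrite inE; apply/asboolP; exists h.
exists (enum_rank_in hch (pattern p h)).
by case: (hsP (enum_rank_in hch (pattern p h))) => _ <-; rewrite enum_rankK_in.
Qed.

Lemma base_expansion_inj q d (a b : 'I_d -> nat) :
    (forall i, a i < q)%N -> (forall i, b i < q)%N ->
    (\sum_(i < d) a i * q ^ i = \sum_(i < d) b i * q ^ i)%N ->
  a =1 b.
Proof.
elim: d a b => [|d IH] a b aq bq; first by move=> _ [].
have expand (c : 'I_d.+1 -> nat) : (\sum_(i < d.+1) c i * q ^ i =
    c ord0 + (\sum_(i < d) c (lift ord0 i) * q ^ i) * q)%N.
  rewrite big_ord_recl muln1 big_distrl/=; congr addn; apply: eq_bigr => i _.
  by rewrite /bump leq0n add1n expnS mulnCA mulnC.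
have q_gt0 : (0 < q)%N by apply: leq_ltn_trans (aq ord0).
rewrite !expand => eqab.
have ab0 : a ord0 = b ord0.
  by have := congr1 (modn^~ q) eqab; rewrite /= ![(_ + _ * q)%N]addnC !modnMDl !modn_small.
move=> i; have [j ->|->//] := unliftP ord0 i.
apply: (IH (a \o lift ord0) (b \o lift ord0)) => [k|k|] /=; rewrite ?aq ?bq//.
by move/eqP: eqab; rewrite ab0 eqn_add2l eqn_pmul2r// => /eqP.
Qed.

Lemma exists_generic d p :
  exists g : 'rV[int]_d, injective (colval (p := p) g).
Proof.
(* With powers of [p.+1] as coefficients, the entries of a column become the digits of its value in
   base [p.+1]. *)
exists (\row_i (p.+1 ^ i)%N%:R) => a b.
have E (c : column d p) : colval (\row_i (p.+1 ^ i)%N%:R) c =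
    (\sum_i c i 0%R * p.+1 ^ i)%N%:R :> int.
  rewrite /colval natr_sum; apply: eq_bigr => i _.
  by rewrite mxE -natrM mulnC.
rewrite !E => /eqP; rewrite eqr_nat => /eqP eqab.
have {}eqab := base_expansion_inj (fun i => ltn_ord (a i 0)) (fun i => ltn_ord (b i 0)) eqab.
by apply/matrixP => i j; rewrite ord1; apply: val_inj; apply: eqab.
Qed.

(* A multiple of [h] is rounded to an integer functional, which is then scaled
   so much that a generic perturbation keeps the strict inequalities. *)
Lemma generic_refinement (R : realType) d p (h : 'rV[R]_d) :
  exists2 h' : 'rV[int]_d, injective (colval (p := p) h') &
    forall a b : column d p, colval h a < colval h b ->
      colval h' a < colval h' b.
Proof.
have [g ginj] := exists_generic d p.
pose L : int := 1 + \sum_(ab : column d p * column d p)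
                      `|colval g ab.1 - colval g ab.2|.
have L_gt (a b : column d p) : `|colval g a - colval g b| < L.
  rewrite /L (bigD1 (a, b))//= addrCA ltrDl ltr_pwDl//.
  exact: sumr_ge0.
(* Rounding a coordinate down loses at most 1 and column entries are at most [p], so [D] bounds the
   loss in the value of any column. *)
pose D : R := \sum_(i < d) p%:R.
(* A sum over all pairs dominates each of its terms, so a single [N] stretches every positive gap of
   [h] to at least [D + 1]; rounding then leaves a gap of at least 1. *)
pose N := (\sum_(ab : column d p * column d p)
  Num.bound ((D + 1) / (colval h ab.2 - colval h ab.1)))%N.
have D_ge0 : 0 <= D by apply: sumr_ge0.
have N_ge (a b : column d p) : colval h a < colval h b ->
    D + 1 <= N%:R * (colval h b - colval h a).
  move=> ab; rewrite -ler_pdivrMr ?subr_gt0//.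
  have: 0 <= (D + 1) / (colval h b - colval h a).
    by apply: divr_ge0; [exact: addr_ge0|rewrite subr_ge0 ltW].
  move=> /archi_boundP/ltW/le_trans; apply.
  by rewrite ler_nat /N (bigD1 (a, b))//= leq_addr.
pose F : 'rV[int]_d := \row_i Num.floor (N%:R * h 0 i).
have F_le (c : column d p) : (colval F c)%:~R <= N%:R * colval h c.
  rewrite -colval_intr /colval mulr_sumr ler_sum// => i _.
  by rewrite mulrA !mxE ler_wpM2r// floor_le.
have F_ge (c : column d p) : N%:R * colval h c <= (colval F c)%:~R + D.
  rewrite -colval_intr /colval mulr_sumr -big_split/= ler_sum// => i _.
  rewrite mulrA !mxE; set z := N%:R * h 0 i.
  have zF : z <= (Num.floor z)%:~R + 1 by rewrite -[1]/1%:~R -intrD ltW// floorD1_gt.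
  apply: (@le_trans _ _ (((Num.floor z)%:~R + 1) * (c i 0 : nat)%:R)).
    by rewrite ler_wpM2r.
  by rewrite mulrDl mul1r lerD2l ler_nat -ltnS.
have F_lt (a b : column d p) : colval h a < colval h b -> 1 <= colval F b - colval F a.
  move=> /N_ge; have := F_le a; have := F_ge b => Fb Fa ab.
  by rewrite -(ler_int R) intrB; move: Fa Fb ab; rewrite mulrBr; lra.
pose h' : 'rV[int]_d := \row_i (L * F 0 i + g 0 i).
have h'E (c : column d p) : colval h' c = L * colval F c + colval g c.
  rewrite /colval mulr_sumr -big_split; apply: eq_bigr => i _.
  by rewrite mxE mulrDl mulrA.
exists h' => a b; rewrite !h'E.
  (* Equal values under [h'] make the difference of the [g] values a multiple of [L] of absolute
     value below [L], hence 0. *)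
  move=> eqab; apply: ginj; apply/eqP.
  rewrite -subr_eq0; have := L_gt a b.
  have -> : colval g a - colval g b = L * (colval F b - colval F a).
    by rewrite mulrBr; lia.
  have L_gt0 : 0 < L by apply: le_lt_trans (L_gt a b).
  rewrite normrM gtr0_norm// mulf_eq0 gtr_pMr// => lt1.
  by apply/orP; right; lia.
move=> /F_lt Fab; have L_gt0 : 0 < L by apply: le_lt_trans (L_gt a b).
have /ltr_normlW := L_gt a b.
have : L <= L * (colval F b - colval F a) by rewrite ler_pMr.
by rewrite mulrBr; lia.
Qed.

(** * Greedy solutions of the chambers: all vertices and convex maximizers *)

Section Optimization.
Variables (R : realType) (d p : nat).
Variable hs : 'I_#|chambers d p| -> 'rV[int]_d.
Hypothesis hs_surj : forall h : 'rV[int]_d, injective (colval (p := p) h) ->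
  exists k, pattern p (hs k) = pattern p h.

(** A functional with ties is refined to a generic integer one, whose pattern is that of some
    [hs k]; thus [h] lies in the closure of that chamber. *)
Lemma chamber_closure (h : 'rV[R]_d) :
  exists k, forall a b : column d p, colval h a < colval h b ->
    colval (hs k) a < colval (hs k) b.
Proof.
have [h' h'inj hh'] := generic_refinement p h.
have [k hk] := hs_surj h'inj; exists k => a b /hh' ab.
have : (a, b) \in pattern p (hs k) by rewrite hk inE.
by rewrite inE.
Qed.

Variables (n : nat) (S : {set vec01 n}) (W : 'M['I_p.+1]_(d, n)).
Variable order : 'I_#|chambers d p| -> seq 'I_n.
Hypothesis matS : is_matroid S.
Hypothesis order_perm : forall k, perm_eq (order k) (enum 'I_n).
Hypothesis order_sorted : forall k,
  sorted (fun i j => colval (hs k) (col j W) <= colval (hs k) (col i W))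
    (order k).

Let X k := greedy_from (independent S) (zero_vec n) (order k).

(* The order of a chamber is also sorted for the functionals in its closure. *)
Lemma greedy_chamber_maximizer (h : 'rV[R]_d) :
  exists k, is_maximizer <=%R S (fun x => (h *m image_vec R W x) 0 0) (X k).
Proof.
have [k hk] := chamber_closure h; exists k.
have so : sorted (fun i j => colval h (col j W) <= colval h (col i W)) (order k).
  apply: sub_sorted (order_sorted k) => i j; rewrite !leNgt.
  by apply: contra => /hk.
have [XS maxX] := greedy_optimal matS (order_perm k) so.
by split=> // z /maxX; rewrite !mul_image_vec.
Qed.

Lemma convex_maximizer (f : 'cV[R]_d -> R) x : convex_function setT f ->
  x \in S -> exists k, f (image_vec R W x) <= f (image_vec R W (X k)).
Proof.
move=> cf xS; apply: (convex_function_max (v := fun k => image_vec R W (X k))) => //.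
move=> h; have [k [_ maxX]] := greedy_chamber_maximizer h.
by exists k; apply: maxX.
Qed.

(** The greedy solution for the functional exposing [v] bounds that functional on the image, hence
    on the hull by a half-space. If its image differed from [v], it would be strictly below [v]. *)
Lemma vertices_greedy v : vertices (conv_hull (image_set R W S)) v ->
  exists k, v = image_vec R W (X k).
Proof.
move=> [vP [h hv]]; have [k [XS maxX]] := greedy_chamber_maximizer h.
exists k; apply/eqP; rewrite eq_sym; apply/negPn/negP => Xv.
have AX : conv_hull (image_set R W S) (image_vec R W (X k)).
  by move=> C /= [_]; apply; exists (X k).
have := hv _ AX Xv; rewrite ltNge => /negP; apply.
suff : (conv_hull (image_set R W S) `<=`
    (fun u => (h *m u) 0 0 <= (h *m image_vec R W (X k)) 0 0))%classic by apply.
apply: smallest_sub => [|_ [x xS ->]]; last exact: maxX.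
exact: convex_halfspace.
Qed.

Lemma card_vertices_le :
  exists2 m, (m <= #|chambers d p|)%N &
    (vertices (conv_hull (image_set R W S)) #= `I_m)%card.
Proof.
set V := vertices _.
have VX : (V #<= `I_#|chambers d p|)%card.
  apply: (@card_le_trans _ _ _ [set: 'I_#|chambers d p|]%classic); last first.
    by rewrite (card_le_eqr card_II).
  apply: card_le_trans (card_image_le (fun k => image_vec R W (X k)) _).
  by apply: subset_card_le => v /vertices_greedy[k ->]; exists k.
have /finite_setP[m Vm] : finite_set V by apply: card_le_finite VX (finite_II _).
by exists m => //; rewrite -card_le_II -(card_le_eql Vm).
Qed.

End Optimization.

(** * Partition matroids and their bases *)

Section PartitionMatroid.
Import boot.fintype boot.finset.
Variables (n : nat) (T : finType) (key : 'I_n -> T).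

(** The independent sets of the partition matroid whose blocks are the fibres of [key]: equality of
    cardinalities says that [key] is injective on [A]. *)
Definition partial_transversals : {set {set 'I_n}} :=
  [set A : {set 'I_n} | #|key @: A| == #|A|].

Lemma partial_transversalP (A : {set 'I_n}) :
  reflect {in A &, injective key} (A \in partial_transversals).
Proof. by rewrite inE; apply: imset_injP. Qed.

(** For the exchange axiom, the larger set has more keys, so one of its elements has a key that the
    smaller set does not use. *)
Lemma partial_transversals_independence :
  independence_family partial_transversals.
Proof.
split=> [|A B AB /partial_transversalP injB|A B AI BI ltAB].
- by rewrite inE imset0 !cards0.
- by apply/partial_transversalP => i j iA jA; apply: injB; apply: (subsetP AB).
have /partial_transversalP injA := AI.
have : (#|key @: A| < #|key @: B|)%N.
  by move: AI BI; rewrite !inE => /eqP-> /eqP->.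
rewrite ltnNge => ltk.
have /subsetPn[_ /imsetP[j jB ->] jA] : ~~ (key @: B \subset key @: A).
  by apply: contra ltk; apply: subset_leq_card.
have njA : j \notin A by apply: contra jA => /(imset_f key).
exists j; first by rewrite inE jB njA.
apply/partial_transversalP => i l; rewrite !inE.
move=> /orP[/eqP->|iA] /orP[/eqP->|lA] eqk //; last exact: injA.
  by case/negP: jA; rewrite eqk imset_f.
by case/negP: jA; rewrite -eqk imset_f.
Qed.

Lemma transversal_basis (s : T -> 'I_n) : cancel s key ->
  s @: [set: T] \in bases partial_transversals.
Proof.
move=> sK; apply/basisP; split.
  by apply/partial_transversalP => _ _ /imsetP[t _ ->] /imsetP[u _ ->]; rewrite !sK => ->.
move=> A; rewrite inE => /eqP AI sA; apply/eqP; rewrite eq_sym eqEcard sA.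
by rewrite card_imset ?cardsT -?AI ?max_card//; apply: can_inj sK.
Qed.

(** The section [s0] shows that no block is empty. A basis missing the block of [t] could be
    enlarged by [s0 t], so it meets every block, and exactly once. *)
Lemma basis_transversal (s0 : T -> 'I_n) (B : {set 'I_n}) : cancel s0 key ->
  B \in bases partial_transversals ->
  exists2 s, cancel s key & B = s @: [set: T].
Proof.
move=> s0K /basisP[BI maxB]; have /partial_transversalP injB := BI.
have /choice[s sB] (t : T) : exists j, j \in B /\ key j = t.
  have [/imsetP[j jB ->]|tB] := boolP (t \in key @: B); first by exists j.
  have sB : s0 t \in B.
    rewrite -(maxB (s0 t |: B)) ?setU11 ?subsetUr//.
    apply/partial_transversalP => i l; rewrite !inE.
    move=> /orP[/eqP->|iA] /orP[/eqP->|lA] //; last exact: injB.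
      by rewrite s0K => tl; case/negP: tB; rewrite tl imset_f.
    by rewrite s0K => tl; case/negP: tB; rewrite -tl imset_f.
  by case/negP: tB; rewrite -(s0K t) imset_f.
exists s => [t|]; first by case: (sB t).
apply/setP => j; apply/idP/imsetP => [jB|[t _ ->]]; last by case: (sB t).
by exists (key j) => //; apply: injB; case: (sB (key j)) => // _ ->.
Qed.

End PartitionMatroid.

Definition realcol (R : realType) d p (c : column d p) : 'cV[R]_d :=
  map_mx (fun a : 'I_p.+1 => (a : nat)%:R) c.

Lemma mul_realcol (R : realType) d p (h : 'rV[R]_d) (c : column d p) :
  (h *m realcol R c) 0 0 = colval h c.
Proof. by rewrite mxE; apply: eq_bigr => i _; rewrite mxE. Qed.

Lemma image_vec_indicator (R : realType) d p n (W : 'M['I_p.+1]_(d, n))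
    (B : {set 'I_n}) :
  image_vec R W (indicator B) = \sum_(j in B) realcol R (col j W).
Proof.
apply/matrixP => i k; rewrite ord1 summxE mxE [RHS]big_mkcond.
apply: eq_bigr => j _; rewrite !mxE ffunE.
by case: (j \in B); rewrite ?mulr1 ?mulr0.
Qed.

(* The segments [[a, b]], for all pairs of columns [a] and [b], add up to a
   polytope whose normal fan is the whole arrangement. *)
Section Zonotope.
Variables (R : realType) (d p : nat).

Let seg := (column d p * column d p)%type.
(** Each segment contributes two ground elements, one per end, which form a block. A basis thus
    selects one end of every segment. *)
Let n := #|{: seg * bool}|.
Let key (j : 'I_n) : seg := (enum_val j).1.
Let side (b : bool) (t : seg) : column d p := if b then t.1 else t.2.
Let item (b : seg -> bool) (t : seg) : 'I_n := enum_rank (t, b t).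

Definition zonotope_weights : 'M['I_p.+1]_(d, n) :=
  \matrix_(i, j) side (enum_val j).2 (enum_val j).1 i 0.

Definition zonotope_matroid : {set vec01 n} :=
  [set indicator B | B in bases (partial_transversals key)]%SET.

Lemma is_matroid_zonotope : is_matroid zonotope_matroid.
Proof.
exists (partial_transversals key) => //.
exact: partial_transversals_independence.
Qed.

Let itemK b : cancel (item b) key.
Proof. by move=> t; rewrite /key enum_rankK. Qed.

Let zpoint (b : seg -> bool) : 'cV[R]_d := \sum_t realcol R (side (b t) t).

Let image_item b : image_vec R zonotope_weights
  (indicator [set item b t | t in [set: seg]%SET]%SET) = zpoint b.
Proof.
rewrite image_vec_indicator big_imset/=; last first.
  by move=> t u _ _; apply: can_inj (itemK b) t u.
rewrite /zpoint; apply: eq_big => [t|t _]; first by rewrite finset.in_setT.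
by congr realcol; apply/matrixP => i j; rewrite ord1 !mxE enum_rankK.
Qed.

Let image_zonotopeP y :
  image_set R zonotope_weights zonotope_matroid y <-> exists b, y = zpoint b.
Proof.
split=> [[x /imsetP[B BB ->] ->]|[b ->]]; last first.
  exists (indicator [set item b t | t in [set: seg]%SET]%SET).
    by apply: imset_f; apply: transversal_basis (itemK b).
  by rewrite image_item.
have [s sK ->] := basis_transversal (itemK xpredT) BB.
exists (fun t => (enum_val (s t)).2); rewrite -image_item.
congr (image_vec _ _ (indicator _)); apply: eq_imset => t.
by apply: enum_val_inj; rewrite enum_rankK [LHS]surjective_pairing -/(key _) sK.
Qed.

Let top (h : 'rV[int]_d) (t : seg) := colval h t.2 < colval h t.1.

(** The sum is maximized segment by segment. Equality is expressed by ends rather than by the bits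
    [b t], since both ends of a degenerate segment coincide. *)
Let zpoint_leif (h : 'rV[int]_d) b : injective (colval (p := p) h) ->
  (map_mx intr h *m zpoint b) 0 0 <= (map_mx intr h *m zpoint (top h)) 0 0
    ?= iff [forall t, side (b t) t == side (top h t) t].
Proof.
move=> hinj; have E c : (map_mx intr h *m zpoint c) 0 0 =
    \sum_t (colval h (side (c t) t))%:~R.
  rewrite mulmx_sumr summxE; apply: eq_bigr => t _.
  by rewrite mul_realcol colval_intr.
rewrite !E; apply: (leif_sum (P := xpredT)
  (C := fun t => side (b t) t == side (top h t) t)) => t _.
have -> : (side (b t) t == side (top h t) t) =
    ((colval h (side (b t) t))%:~R == (colval h (side (top h t) t))%:~R :> R).
  by rewrite eqr_int (inj_eq hinj).
apply: leif_eq; rewrite ler_int /top.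
by case: (b t); case: ltP => //= /ltW.
Qed.

Let zpoint_side (h : 'rV[int]_d) b : injective (colval (p := p) h) ->
  zpoint b = zpoint (top h) -> forall t, side (b t) t = side (top h t) t.
Proof.
move=> hinj bt t; have [_] := zpoint_leif b hinj.
by rewrite bt eqxx => /esym/forallP/(_ t)/eqP.
Qed.

Let vertices_zpoint h : injective (colval (p := p) h) ->
  vertices (conv_hull (image_set R zonotope_weights zonotope_matroid))
    (zpoint (top h)).
Proof.
move=> hinj; apply: (vertices_conv_hull (h := map_mx intr h)).
  by apply/image_zonotopeP; exists (top h).
move=> _ /image_zonotopeP[b ->] bt; rewrite (lt_leif (zpoint_leif b hinj)).
apply: contra bt => /forallP bt; apply/eqP/eq_bigr => t _.
by rewrite (eqP (bt t)).
Qed.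

(** The general bound gives one inequality; for the other, the points [zpoint (top (hs k))] are
    vertices, distinct for distinct chambers. *)
Lemma card_vertices_zonotope :
  (vertices (conv_hull (image_set R zonotope_weights zonotope_matroid))
     #= `I_#|chambers d p|)%card.
Proof.
have [hs [hs_inj hs_pattern hs_surj]] := chamber_representatives d p.
pose order k := sort
  (fun i j => colval (hs k) (col j zonotope_weights)
           <= colval (hs k) (col i zonotope_weights)) (enum 'I_n).
have order_perm k : perm_eq (order k) (enum 'I_n) by rewrite perm_sort.
have order_sorted k := sort_sorted (fun i j => le_total
  (colval (hs k) (col j zonotope_weights)) (colval (hs k) (col i zonotope_weights))) (enum 'I_n).
have [m le_m Vm] := card_vertices_le R hs_surj is_matroid_zonotope order_perm order_sorted.
suff <- : m = #|chambers d p| by [].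
apply/eqP; rewrite eqn_leq le_m/= -card_le_II -(card_le_eqr Vm).
rewrite (card_le_eql card_II).
have zinj : injective (fun k => zpoint (top (hs k))).
  move=> k l kl; apply: hs_pattern; apply/finset.setP => -[a b]; rewrite !inE/=.
  have [->|ab] := eqVneq a b; first by rewrite !ltxx.
  (* On the segment [(b, a)], [top] is exactly the test for [(a, b)] in the pattern. *)
  have := zpoint_side (hs_inj l) kl (b, a); rewrite /side /top/=.
  by case: ifP; case: ifP => // _ _ /eqP; rewrite ?[b == a]eq_sym (negPf ab).
rewrite -(card_le_eql (inj_card_eq (in2W zinj))); apply: subset_card_le.
by move=> _ [k _ <-]; apply: vertices_zpoint.
Qed.
End Zonotope.

(** * A program logic for the RAM *)

Fixpoint wvars (c : cmd) (v : nat) : bool :=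
  match c with
  | CSet u _ | CIndep u _ | CComp u _ _ => u == v
  | CSeq c1 c2 | CIf _ _ c1 c2 => wvars c1 v || wvars c2 v
  | CWhile _ _ c => wvars c v
  | CSkip | CPut _ _ _ | CObjective _ => false
  end.

Fixpoint warrs (c : cmd) (a : nat) : bool :=
  match c with
  | CPut b _ _ => b == a
  | CSeq c1 c2 | CIf _ _ c1 c2 => warrs c1 a || warrs c2 a
  | CWhile _ _ c => warrs c a
  | CSkip | CSet _ _ | CObjective _ | CIndep _ _ | CComp _ _ _ => false
  end.

Definition frame (c : cmd) (s s' : store) : Prop :=
  (forall v, ~~ wvars c v -> var s' v = var s v) /\
  (forall a, ~~ warrs c a -> arr s' a = arr s a).

(* Bounds the time only of programs whose loops make at most [n] iterations. *)
Fixpoint cost (n d : nat) (c : cmd) : nat :=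
  match c with
  | CSkip => 1
  | CSet _ e => (esize e).+1
  | CPut _ e1 e2 => (esize e1 + esize e2).+1
  | CSeq c1 c2 => cost n d c1 + cost n d c2
  | CIf e1 e2 c1 c2 => (esize e1 + esize e2 + (cost n d c1 + cost n d c2)).+1
  | CWhile e1 e2 c =>
      n * (esize e1 + esize e2 + cost n d c).+1 + (esize e1 + esize e2).+1
  | CObjective _ | CIndep _ _ => n.+1
  | CComp _ _ _ => (d + d).+1
  end.

(** Bounds of the form [K * n.+1 ^ e] are closed under addition and under multiplication by [n],
    which covers sequencing and loops. The base [n.+1] keeps them positive at [n = 0]. *)
Lemma cost_polynomial d c :
  exists K e, forall n, (cost n d c <= K * n.+1 ^ e)%N.
Proof.
have cst k : exists K e, forall n, (k <= K * n.+1 ^ e)%N.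
  by exists k, 0%N => n; rewrite muln1.
have lin : exists K e, forall n, (n.+1 <= K * n.+1 ^ e)%N.
  by exists 1%N, 1%N => n; rewrite mul1n.
have add f g : (exists K e, forall n, (f n <= K * n.+1 ^ e)%N) ->
    (exists K e, forall n, (g n <= K * n.+1 ^ e)%N) ->
    exists K e, forall n, (f n + g n <= K * n.+1 ^ e)%N.
  move=> [K [e fK]] [L [e' gL]]; exists (K + L)%N, (e + e')%N => n.
  rewrite mulnDl leq_add// ?(leq_trans (fK n))// ?(leq_trans (gL n))//.
    by rewrite leq_mul// leq_pexp2l// leq_addr.
  by rewrite leq_mul// leq_pexp2l// leq_addl.
elim: c => //= [c1 IH1 c2 IH2|e1 e2 c1 IH1 c2 IH2|e1 e2 c IH].
- exact: add.
- have [K [e H]] := add _ _ (cst (esize e1 + esize e2).+1) (add _ _ IH1 IH2).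
  by exists K, e.
- have [K [e H]] := add _ _ (cst (esize e1 + esize e2).+1) IH.
  have [|K' [e' H']] := add (fun n => n * (esize e1 + esize e2 + cost n d c).+1)%N
    _ _ (cst (esize e1 + esize e2).+1).
    exists K, e.+1 => n; rewrite expnS mulnCA.
    by apply: leq_mul => //; apply: H.
  by exists K', e'.
Qed.

Definition cseqs : seq cmd -> cmd := foldr CSeq CSkip.

Lemma wvars_cseqs (T : Type) (g : T -> cmd) r v :
  (forall i, ~~ wvars (g i) v) -> ~~ wvars (cseqs [seq g i | i <- r]) v.
Proof. by move=> gv; elim: r => //= i r IH; rewrite negb_or gv. Qed.

Lemma warrs_cseqs (T : Type) (g : T -> cmd) r a :
  (forall i, ~~ warrs (g i) a) -> ~~ warrs (cseqs [seq g i | i <- r]) a.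
Proof. by move=> ga; elim: r => //= i r IH; rewrite negb_or ga. Qed.

(* Variable 0 holds [n] and variable 1 is the only loop counter. *)
Definition cfor (body : cmd) : cmd :=
  CSeq (CSet 1 (EConst 0))
    (CWhile (EVar 1) (EVar 0)
      (CSeq body (CSet 1 (EAdd (EVar 1) (EConst 1))))).

Section Spec.
Variables (n d : nat) (indep : vec01 n -> bool).
Variable comp : 'cV[int]_d -> 'cV[int]_d -> bool.

(** Total correctness: some run halts within the syntactic cost, and the postcondition sees the
    final store and the log. *)
Definition spec (c : cmd) (s : store)
    (Q : store -> seq (event n) -> Prop) : Prop :=
  exists s' t l,
    [/\ exec indep comp c s s' t l, (t <= cost n d c)%N & Q s' l].

Lemma exec_frame c s s' t l : exec indep comp c s s' t l -> frame c s s'.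
Proof.
have updE (A : Type) (g : nat -> A) k a k' : k != k' -> upd g k a k' = g k'.
  by rewrite /upd eq_sym => /negPf ->.
elim=> {c s s' t l} //=.
- by move=> v e s; split=> //= u uv; rewrite updE.
- by move=> a e1 e2 s; split=> //= u ua; rewrite updE.
- move=> c1 c2 s s1 s2 t1 t2 l1 l2 _ [v1 a1] _ [v2 a2].
  by split=> u /=; rewrite negb_or => /andP[? ?]; rewrite ?v2 ?v1 ?a2 ?a1.
- move=> e1 e2 c1 c2 s s1 t l _ [v1 a1].
  split=> u; rewrite /= negb_or => /andP[u1 u2]; first by apply: v1; case: ifP.
  by apply: a1; case: ifP.
- move=> e1 e2 c s s1 s2 t1 t2 l1 l2 _ _ [v1 a1] _ [v2 a2].
  by split=> u u1; rewrite ?v2 ?v1 ?a2 ?a1.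
- by move=> v a s; split=> //= u uv; rewrite updE.
- by move=> v a b s; split=> //= u uv; rewrite updE.
Qed.

Lemma spec_weaken c s (Q Q' : store -> seq (event n) -> Prop) : spec c s Q ->
  (forall s' l, frame c s s' -> Q s' l -> Q' s' l) -> spec c s Q'.
Proof.
move=> [s' [t [l [ex tc Qs]]]] QQ'; exists s', t, l; split=> //.
exact: QQ' (exec_frame ex) Qs.
Qed.

Lemma spec_skip s (Q : store -> seq (event n) -> Prop) :
  Q s [::] -> spec CSkip s Q.
Proof. by move=> Qs; exists s, 1%N, [::]; split=> //; apply: exec_skip. Qed.

Lemma spec_set v e s (Q : store -> seq (event n) -> Prop) :
  Q (set_var s v (eval s e)) [::] -> spec (CSet v e) s Q.
Proof. by move=> Qs; do 3!eexists; split; [exact: exec_set|..]. Qed.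

Lemma spec_put a e1 e2 s (Q : store -> seq (event n) -> Prop) :
  Q (set_arr s a (eval s e1) (eval s e2)) [::] -> spec (CPut a e1 e2) s Q.
Proof. by move=> Qs; do 3!eexists; split; [exact: exec_put|..]. Qed.

(** The second premise receives the frame of [c1], so [Q1] need not mention what [c1] cannot
    write. *)
Lemma spec_seq c1 c2 s (Q1 Q : store -> seq (event n) -> Prop) :
    spec c1 s Q1 ->
    (forall s1 l1, frame c1 s s1 -> Q1 s1 l1 ->
       spec c2 s1 (fun s2 l2 => Q s2 (l1 ++ l2))) ->
  spec (CSeq c1 c2) s Q.
Proof.
move=> [s1 [t1 [l1 [ex1 tc1 Q1s]]]] H.
have [s2 [t2 [l2 [ex2 tc2 Qs]]]] := H _ _ (exec_frame ex1) Q1s.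
exists s2, (t1 + t2)%N, (l1 ++ l2); split=> //; last exact: leq_add.
exact: exec_seq ex1 ex2.
Qed.

Lemma spec_if e1 e2 c1 c2 s (Q : store -> seq (event n) -> Prop) :
  spec (if eval s e1 < eval s e2 then c1 else c2) s Q ->
  spec (CIf e1 e2 c1 c2) s Q.
Proof.
move=> [s' [t [l [ex tc Qs]]]]; exists s', (esize e1 + esize e2 + t).+1, l.
split=> //; first exact: exec_if.
rewrite /= ltnS leq_add2l (leq_trans tc)//.
by case: ifP; rewrite ?leq_addr ?leq_addl.
Qed.

Lemma spec_objective a s (Q : store -> seq (event n) -> Prop) :
  Q s [:: Objective (read_weights n s a)] -> spec (CObjective a) s Q.
Proof. by move=> Qs; do 3!eexists; split; [exact: exec_objective|..]. Qed.

Lemma spec_indep v a s (Q : store -> seq (event n) -> Prop) :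
  Q (set_var s v (indep (read_bits n s a) : nat)%:Z) [:: Query (read_bits n s a)] ->
  spec (CIndep v a) s Q.
Proof. by move=> Qs; do 3!eexists; split; [exact: exec_indep|..]. Qed.

Lemma spec_comp v a b s (Q : store -> seq (event n) -> Prop) :
  Q (set_var s v (comp (read_point d s a) (read_point d s b) : nat)%:Z) [::] ->
  spec (CComp v a b) s Q.
Proof. by move=> Qs; do 3!eexists; split; [exact: exec_comp|..]. Qed.

Lemma spec_cseqs (T : Type) (g : T -> cmd) (r : seq T) s
    (Inv : seq T -> store -> seq (event n) -> Prop) :
    (forall pre i s l, Inv pre s l ->
       spec (g i) s (fun s' l' => Inv (rcons pre i) s' (l ++ l'))) ->
    Inv [::] s [::] ->
  spec (cseqs [seq g i | i <- r]) s (Inv r).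
Proof.
move=> step; suff H pre s0 l : Inv pre s0 l ->
    spec (cseqs [seq g i | i <- r]) s0 (fun s' l' => Inv (pre ++ r) s' (l ++ l')).
  exact: H.
elim: r pre s0 l => [|i r IH] pre s0 l Is; first by apply: spec_skip; rewrite !cats0.
apply: (spec_seq (step pre i _ _ Is)) => s1 l1 _ /IH Is1.
by apply: (spec_weaken Is1) => s2 l2 _; rewrite cat_rcons catA.
Qed.

(** As the body writes neither the counter nor variable 0, there are exactly [n] iterations, as
    [cost] assumes. The invariant sees only the scanned prefix, the arrays and the log, so
    incrementing the counter preserves it. *)
Lemma spec_for body s
    (Inv : seq 'I_n -> (nat -> int -> int) -> seq (event n) -> Prop) :
    var s 0 = n -> ~~ wvars body 0 -> ~~ wvars body 1 ->
    (forall pre (j : 'I_n) s1 l, var s1 0 = n -> var s1 1 = (j : nat) ->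
       (forall a, ~~ warrs body a -> arr s1 a = arr s a) ->
       Inv pre (arr s1) l ->
       spec body s1 (fun s2 l' => Inv (rcons pre j) (arr s2) (l ++ l'))) ->
    Inv [::] (arr s) [::] ->
  spec (cfor body) s (fun s' l => Inv (enum 'I_n) (arr s') l).
Proof.
move=> s0 b0 b1 step I0.
pose loop := CWhile (EVar 1) (EVar 0)
  (CSeq body (CSet 1 (EAdd (EVar 1) (EConst 1)))).
(* Here [i] iterations are done and [k] remain. The guard has size 2, the increment costs 4 and the
   final failing test 3. *)
have H k i s1 l : (i + k = n)%N -> var s1 0 = n -> var s1 1 = i ->
    (forall a, ~~ warrs body a -> arr s1 a = arr s a) ->
    Inv (take i (enum 'I_n)) (arr s1) l ->
    exists s' t l', [/\ exec indep comp loop s1 s' t l',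
      (t <= k * (2 + (cost n d body + 4)).+1 + 3)%N & Inv (enum 'I_n) (arr s') (l ++ l')].
  elim: k i s1 l => [|k IH] i s1 l ikn v0 v1 fr Is.
    exists s1, 3%N, [::]; split=> //.
      by apply: exec_while_end; rewrite /= v0 v1 -ikn addn0 ltxx.
    by rewrite cats0 -[X in Inv X](take_oversize (n := i)) ?size_enum_ord// -ikn addn0.
  have ltin : (i < n)%N by rewrite -ikn addnS ltnS leq_addr.
  have [s2 [t2 [l2 [ex2 tc2 Is2]]]] := step _ (Ordinal ltin) _ _ v0 v1 fr Is.
  have [fv fa] := exec_frame ex2.
  pose s3 := set_var s2 1 (eval s2 (EAdd (EVar 1) (EConst 1))).
  have [|||||s4 [t4 [l4 [ex4 tc4 Is4]]]] := IH i.+1 s3 (l ++ l2) _ _ _ _ _.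
  - by rewrite addSnnS.
  - by rewrite /= /upd /= fv.
  - by rewrite /= /upd /= fv// v1 -addn1 PoszD.
  - by move=> a ab /=; rewrite fa ?fr.
  - rewrite (take_nth (Ordinal ltin)) ?size_enum_ord//.
    by rewrite (_ : nth _ _ _ = Ordinal ltin)//; apply: val_inj; rewrite /= nth_enum_ord.
  exists s4, (2 + (t2 + 4) + t4).+1, (l2 ++ l4); split.
  - rewrite -[l2 in l2 ++ l4]cats0.
    apply: (exec_while_step _ _ ex4); first by rewrite /= v0 v1 ltz_nat.
    by apply: exec_seq ex2 _; apply: exec_set.
  - lia.
  - by rewrite catA.
pose s1 := set_var s 1 0.
have I1 : Inv (take 0 (enum 'I_n)) (arr s1) [::] by rewrite take0.
have [s' [t [l [ex tc Is]]]] :=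
  H n 0%N s1 [::] (add0n n) s0 erefl (fun _ _ => erefl) I1.
exists s', (2 + t)%N, ([::] ++ l); split=> //.
  by apply: exec_seq ex; apply: exec_set.

Qed.

End Spec.

Arguments spec_set {n d indep comp v e s} Q.
Arguments spec_put {n d indep comp a e1 e2 s} Q.
Arguments spec_indep {n d indep comp v a s} Q.

(** * The algorithm *)

(** Multiplication by a constant is unrolled into additions, the machine having no product; the size
    of the result does not depend on the input. *)
Fixpoint emuln (k : nat) (e : expr) : expr :=
  if k is k'.+1 then EAdd e (emuln k' e) else EConst 0.

Definition emulz (z : int) (e : expr) : expr :=
  match z with
  | Posz k => emuln k e
  | Negz k => ESub (EConst 0) (emuln k.+1 e)
  end.

Lemma eval_emuln s k e : eval s (emuln k e) = k%:Z * eval s e.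
Proof.
by elim: k => [|k /= ->]; rewrite ?mul0r// -[k.+1]addn1 PoszD mulrDl mul1r addrC.
Qed.

Lemma eval_emulz s z e : eval s (emulz z e) = z * eval s e.
Proof.
case: z => k; first exact: eval_emuln.
by rewrite NegzE mulNr -eval_emuln /= sub0r.
Qed.

(* Arrays: 0 holds [W], 1 the best solution and 6 its image, 2 the weights,
   4 the current solution and 5 its image.  Variables: 2 and 4 hold the answers
   of the oracles, 3 a saved bit, and 5 tells whether there is a best solution. *)

Definition entry d (i : nat) : expr :=
  EGet 0 (EAdd (emuln d (EVar 1)) (EConst i%:Z)).

Definition weight d (h : 'rV[int]_d) : expr :=
  foldr (fun i e => EAdd (emulz (h 0 i) (entry d i)) e) (EConst 0) (enum 'I_d).

Definition set_weights d (h : 'rV[int]_d) : cmd :=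
  CSeq (cfor (CPut 2 (EVar 1) (weight h))) (CObjective 2).

Definition reset : cmd := cfor (CPut 4 (EVar 1) (EConst 0)).

Definition try_element : cmd :=
  CSeq (CSet 3 (EGet 4 (EVar 1)))
  (CSeq (CPut 4 (EVar 1) (EConst 1))
  (CSeq (CIndep 2 4)
    (CIf (EVar 2) (EConst 1) (CPut 4 (EVar 1) (EVar 3)) CSkip))).

(** Branching only tests [<], so equality of a weight with [t] is the failure of both strict
    comparisons. *)
Definition try_value (t : int) : cmd :=
  cfor (CIf (EGet 2 (EVar 1)) (EConst t) CSkip
       (CIf (EConst t) (EGet 2 (EVar 1)) CSkip try_element)).

(** All columns are listed, not only those of [W], so that the program is the same for every
    input. *)
Definition values d p (h : 'rV[int]_d) : seq int :=
  sort >=%R (undup [seq colval h c | c <- enum {: column d p}]).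

Definition greedy d p (h : 'rV[int]_d) : cmd :=
  cseqs [seq try_value t | t <- values p h].

Definition coordinate d (i : nat) : cmd :=
  CSeq (CPut 5 (EConst i%:Z) (EConst 0))
    (cfor (CIf (EConst 0) (EGet 4 (EVar 1))
       (CPut 5 (EConst i%:Z) (EAdd (EGet 5 (EConst i%:Z)) (entry d i))) CSkip)).

Definition set_image d : cmd := cseqs [seq coordinate d i | i <- iota 0 d].

(** As long as nothing has been saved, the current solution wins without an oracle call. *)
Definition compare : cmd :=
  CIf (EVar 5) (EConst 1) (CSet 4 (EConst 1)) (CComp 4 6 5).

Definition save_best d : cmd :=
  CSeq (cfor (CPut 1 (EVar 1) (EGet 4 (EVar 1))))
  (CSeq (cseqs [seq CPut 6 (EConst i%:Z) (EGet 5 (EConst i%:Z)) | i <- iota 0 d])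
    (CSet 5 (EConst 1))).

Definition solve_linear d p (h : 'rV[int]_d) : cmd :=
  CSeq (set_weights h) (CSeq reset (CSeq (greedy p h) (set_image d))).

Definition update_best d : cmd :=
  CSeq compare (CIf (EConst 0) (EVar 4) (save_best d) CSkip).

Definition solve_convex d p m (hs : 'I_m -> 'rV[int]_d) : cmd :=
  cseqs [seq CSeq (solve_linear p (hs k)) (update_best d) | k <- enum 'I_m].

(** * Correctness of the program *)

Section Correctness.
Variables (d p n : nat) (W : 'M['I_p.+1]_(d, n)).
Variables (indep : vec01 n -> bool) (comp : 'cV[int]_d -> 'cV[int]_d -> bool).
Local Notation spec := (spec indep comp).

Definition has_bits (A : int -> int) (x : vec01 n) :=
  forall j : 'I_n, A (j : nat)%:Z = (x j : nat)%:Z.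

Definition weights (h : 'rV[int]_d) : {ffun 'I_n -> int} :=
  [ffun j => colval h (col j W)].

Definition image_int (x : vec01 n) : 'cV[int]_d :=
  \col_i \sum_j (W i j : nat)%:Z * (x j : nat)%:Z.

(** The order realized by the scans: one bucket per value, in decreasing order of values, and
    increasing indices within a bucket. *)
Definition value_order (h : 'rV[int]_d) : seq 'I_n :=
  flatten [seq [seq j <- enum 'I_n | colval h (col j W) == t] | t <- values p h].

Lemma greedy_from_cat (x : vec01 n) r1 r2 :
  greedy_from indep x (r1 ++ r2) = greedy_from indep (greedy_from indep x r1) r2.
Proof. by elim: r1 x => //=. Qed.

Lemma greedy_queries_cat (x : vec01 n) r1 r2 :
  greedy_queries indep x (r1 ++ r2) =
  greedy_queries indep x r1 ++ greedy_queries indep (greedy_from indep x r1) r2.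
Proof. by elim: r1 x => //= j r1 IH x; rewrite IH. Qed.

Lemma mem_values h j : colval h (col j W) \in values p h.
Proof. by rewrite mem_sort mem_undup (map_f (fun c => colval h c)) ?mem_enum. Qed.

Lemma value_order_perm h : perm_eq (value_order h) (enum 'I_n).
Proof.
apply: uniq_perm; rewrite ?enum_uniq//.
  have: uniq (values p h) by rewrite sort_uniq undup_uniq.
  rewrite /value_order; elim: (values p h) => //= t r IH /andP[tr ur].
  rewrite cat_uniq filter_uniq ?enum_uniq//= IH// andbT.
  apply/hasPn => j /flattenP[_ /mapP[u ur1 ->]]; rewrite mem_filter => /andP[/eqP ju _].
  by rewrite /= mem_filter ju mem_enum andbT; apply: contraNneq tr => <-.
move=> j; rewrite mem_enum inE; apply/flattenP.
exists [seq i <- enum 'I_n | colval h (col i W) == colval h (col j W)].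
  by apply: map_f (mem_values h j).
by rewrite mem_filter eqxx mem_enum.
Qed.

Lemma value_order_sorted h :
  sorted (fun i j => colval h (col j W) <= colval h (col i W)) (value_order h).
Proof.
pose le i j := colval h (col j W) <= colval h (col i W).
have le_tr : transitive le by move=> j i k ji kj; apply: le_trans ji.
have ge_tr : transitive (>=%R : rel int) by move=> y x z /[swap]; apply: le_trans.
have: pairwise >=%R (values p h).
  by rewrite -sorted_pairwise//; apply: sort_sorted => x y; apply: le_total.
rewrite sorted_pairwise// /value_order.
elim: (values p h) => //= t r IH /andP[/allP tr /IH le_r].
rewrite pairwise_cat le_r andbT; apply/andP; split.
  apply/allrelP => i j; rewrite mem_filter => /andP[/eqP it _].
  move=> /flattenP[_ /mapP[u ur ->]]; rewrite mem_filter => /andP[/eqP ju _].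
  by rewrite /le it ju; apply: tr.
elim: (enum 'I_n) => //= i s IHs; case: ifP => //= /eqP it.
rewrite IHs andbT; apply/allP => j; rewrite mem_filter => /andP[/eqP jt _].
by rewrite /le it jt.
Qed.

Lemma has_bits_read s a x : has_bits (arr s a) x -> read_bits n s a = x.
Proof. by move=> ax; apply/ffunP => j; rewrite ffunE ax; case: (x j). Qed.

Lemma eval_entry s (i : 'I_d) (j : 'I_n) :
  arr s 0 = arr (input W) 0 -> var s 1 = (j : nat) ->
  eval s (entry d i) = (W i j : nat)%:Z.
Proof.
move=> a0 v1; rewrite /= eval_emuln a0 /= v1.
have -> : d%:Z * (j : nat)%:Z + (i : nat)%:Z = Posz (j * d + i).
  by rewrite PoszD PoszM mulrC.
have d_gt0 : (0 < d)%N by apply: leq_ltn_trans (ltn_ord i).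
by rewrite modnMDl modn_small// divnMDl// divn_small// addn0 !valK.
Qed.

Lemma eval_weight s h (j : 'I_n) :
  arr s 0 = arr (input W) 0 -> var s 1 = (j : nat) ->
  eval s (weight h) = weights h j.
Proof.
move=> a0 v1; rewrite ffunE /colval /weight -big_enum /=.
elim: (enum 'I_d) => [|i r IH]; first by rewrite big_nil.
rewrite big_cons -IH [LHS]/= eval_emulz; congr (_ * _ + _).
by rewrite (eval_entry i a0 v1) mxE natz.
Qed.

Lemma spec_set_weights h s : var s 0 = n -> arr s 0 = arr (input W) 0 ->
  spec (set_weights h) s (fun s' l => l = [:: Objective (weights h)] /\
    forall j : 'I_n, arr s' 2 (j : nat)%:Z = weights h j).
Proof.
move=> s0 a0; apply: spec_seq.
  apply: (spec_for (Inv := fun pre A l => l = [::] /\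
    forall j : 'I_n, j \in pre -> A 2%N (j : nat)%:Z = weights h j)) => //.
  move=> pre j s1 l v0 v1 fr [-> Is]; apply: spec_put; split=> // k.
  have wj : eval s1 (weight h) = weights h j by rewrite (eval_weight _ _ v1)// fr.
  rewrite mem_rcons inE /= /upd eqxx v1 eqz_nat (inj_eq (@ord_inj n)) wj.
  by case: eqVneq => [->//|_] /= /Is.
move=> s1 _ _ [-> Is]; apply: spec_objective; split.
  congr [:: Objective _]; apply/ffunP => j; rewrite ffunE Is//.
  by rewrite mem_enum.
by move=> j; apply: Is; rewrite mem_enum.
Qed.

Lemma spec_reset s : var s 0 = n ->
  spec reset s (fun s' l => l = [::] /\ has_bits (arr s' 4) (zero_vec n)).
Proof.
move=> s0.
apply: (spec_weaken (Q := fun s' l => l = [::] /\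
    forall j : 'I_n, j \in enum 'I_n -> arr s' 4 (j : nat)%:Z = 0)); last first.
  by move=> s' l _ [-> Is]; split=> // j; rewrite Is ?mem_enum// ffunE.
apply: (spec_for (Inv := fun pre A l => l = [::] /\
  forall j : 'I_n, j \in pre -> A 4%N (j : nat)%:Z = 0)) => //.
move=> pre j s1 l v0 v1 fr [-> Is]; apply: spec_put; split=> // k.
rewrite mem_rcons inE /= /upd eqxx v1 eqz_nat (inj_eq (@ord_inj n)).
by case: (k == j) => //=; apply: Is.
Qed.

Lemma spec_try_element s (x : vec01 n) (j : 'I_n) :
    var s 1 = (j : nat) -> has_bits (arr s 4) x ->
  let y := add_elt x j in
  spec try_element s (fun s' l => l = [:: Query y] /\
    has_bits (arr s' 4) (if indep y then y else x)).
Proof.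
move=> v1 ax y; apply: spec_seq.
  apply: (spec_set (fun s' l => l = [::] /\
    var s' 3 = arr s 4 (j : nat)%:Z)).
  by rewrite /= /upd /= v1.
move=> s1 l1 [f1 g1] [-> v3] {l1}.
have ax1 : has_bits (arr s1 4) x by rewrite g1.
have v11 : var s1 1 = (j : nat) by rewrite f1.
apply: spec_seq.
  apply: (spec_put (fun s' l => l = [::] /\ has_bits (arr s' 4) y)).
  split=> // k; rewrite /= /upd eqxx v11 eqz_nat (inj_eq (@ord_inj n)) /y ffunE.
  by rewrite ax1; case: (k == j).
move=> s2 l2 [f2 g2] [-> ay] {l2}; apply: spec_seq.
  apply: (spec_indep (fun s' l => l = [:: Query y] /\
    var s' 2 = (indep y : nat))).
  by rewrite (has_bits_read ay).
move=> s3 l3 [f3 g3] [-> v2] {l3}; apply: spec_if => /=.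
rewrite v2; case: (indep y) => /=; first by apply: spec_skip; rewrite g3.
apply: spec_put; split=> // k.
rewrite /= /upd eqxx f3// f2// v11 eqz_nat (inj_eq (@ord_inj n)).
case: eqVneq => [->|kj]; first by rewrite f3// f2// v3 ax.
by rewrite g3// ay ffunE (negPf kj).
Qed.

Lemma spec_try_value t h s (x : vec01 n) :
    var s 0 = n -> (forall j : 'I_n, arr s 2 (j : nat)%:Z = weights h j) ->
    has_bits (arr s 4) x ->
  let r := [seq j <- enum 'I_n | colval h (col j W) == t] in
  spec (try_value t) s (fun s' l =>
    l = [seq Query q | q <- greedy_queries indep x r] /\
    has_bits (arr s' 4) (greedy_from indep x r)).
Proof.
move=> s0 sw sx; apply: (spec_for (Inv := fun pre A l =>
    let r := [seq j <- pre | colval h (col j W) == t] in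
    l = [seq Query q | q <- greedy_queries indep x r] /\
    has_bits (A 4%N) (greedy_from indep x r))) => //.
move=> pre j s1 l v0 v1 fr /= [-> Is].
apply: spec_if; rewrite /= v1 fr// sw ffunE filter_rcons.
case: ltgtP => jt; rewrite ?jt.
- by apply: spec_skip; rewrite cats0.
- by apply: spec_if; rewrite /= v1 fr// sw ffunE jt; apply: spec_skip; rewrite cats0.
apply: spec_if; rewrite /= v1 fr// sw ffunE jt ltxx.
apply: (spec_weaken (spec_try_element v1 Is)) => s2 _ _ [-> Is2].
by rewrite -cats1 greedy_from_cat greedy_queries_cat map_cat.
Qed.

Lemma spec_greedy h s :
    var s 0 = n -> (forall j : 'I_n, arr s 2 (j : nat)%:Z = weights h j) ->
    has_bits (arr s 4) (zero_vec n) ->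
  let r := value_order h in
  spec (greedy p h) s (fun s' l =>
    l = [seq Query q | q <- greedy_queries indep (zero_vec n) r] /\
    has_bits (arr s' 4) (greedy_from indep (zero_vec n) r)).
Proof.
move=> s0 sw sx.
pose Inv (pre : seq int) s' l :=
  let r := flatten [seq [seq j <- enum 'I_n | colval h (col j W) == t] | t <- pre] in
  [/\ var s' 0 = n, arr s' 2 = arr s 2,
    l = [seq Query q | q <- greedy_queries indep (zero_vec n) r] &
    has_bits (arr s' 4) (greedy_from indep (zero_vec n) r)].
apply: (spec_weaken (Q := Inv (values p h))) => [|s' l _ []//].
apply: spec_cseqs => //.
move=> pre t s1 l [v0 a2 -> Is].
apply: (spec_weaken (spec_try_value t (h := h) v0 _ Is)); first by move=> j; rewrite a2.
move=> s2 _ [f g] [-> Is2]; split; rewrite ?f// ?(g 2%N)//.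
  by rewrite map_rcons flatten_rcons greedy_queries_cat map_cat.
by rewrite map_rcons flatten_rcons greedy_from_cat.
Qed.

Lemma spec_coordinate s (x : vec01 n) (i : 'I_d) :
    var s 0 = n -> arr s 0 = arr (input W) 0 -> has_bits (arr s 4) x ->
  spec (coordinate d i) s (fun s' l => [/\ l = [::],
    arr s' 5 (i : nat)%:Z = image_int x i 0 &
    forall z, z != (i : nat)%:Z -> arr s' 5 z = arr s 5 z]).
Proof.
move=> s0 a0 ax; apply: spec_seq.
  apply: (spec_put (fun s' l => [/\ l = [::], arr s' 5 (i : nat)%:Z = 0 &
    forall z, z != (i : nat)%:Z -> arr s' 5 z = arr s 5 z])).
  by split=> //= [|z zi]; rewrite /upd /= ?eqxx ?(negPf zi).
move=> s1 l1 [f1 g1] [-> z5 o5] {l1}.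
apply: (spec_weaken (Q := fun s' l => [/\ l = [::],
  arr s' 5 (i : nat)%:Z = \sum_(j <- enum 'I_n) (W i j : nat)%:Z * (x j : nat)%:Z &
  forall z, z != (i : nat)%:Z -> arr s' 5 z = arr s 5 z])); last first.
  by move=> s' l _ [-> -> oz]; rewrite mxE big_enum.
apply: (spec_for (Inv := fun pre A l => [/\ l = [::],
  A 5%N (i : nat)%:Z = \sum_(j <- pre) (W i j : nat)%:Z * (x j : nat)%:Z &
  forall z, z != (i : nat)%:Z -> A 5%N z = arr s 5 z])) => //.
- by rewrite f1.
- move=> pre j s2 l v0 v1 fr [-> Is oz].
  have a02 : arr s2 0 = arr (input W) 0 by rewrite fr// g1.
  apply: spec_if; rewrite /= v1 fr// g1// ax big_rcons/=.
  case: (x j) => /=; last by apply: spec_skip; rewrite mulr0 addr0.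
  apply: spec_put; split=> // [|z zi]; rewrite /= /upd /=; last first.
    by rewrite (negPf zi) oz.
  by have /= -> := eval_entry i a02 v1; rewrite eqxx Is mulr1.
- by rewrite big_nil.
Qed.

Lemma spec_set_image s (x : vec01 n) :
    var s 0 = n -> arr s 0 = arr (input W) 0 -> has_bits (arr s 4) x ->
  spec (set_image d) s (fun s' l => l = [::] /\ read_point d s' 5 = image_int x).
Proof.
move=> s0 a0 ax.
pose Inv (pre : seq 'I_d) s' (l : seq (event n)) := [/\ l = [::], var s' 0 = n,
  arr s' 0 = arr s 0, arr s' 4 = arr s 4 &
  forall i : 'I_d, i \in pre -> arr s' 5 (i : nat)%:Z = image_int x i 0].
rewrite /set_image -val_enum_ord -map_comp.
apply: (spec_weaken (Q := Inv (enum 'I_d))); last first.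
  move=> s' l _ [-> _ _ _ Is]; split=> //; apply/matrixP => i j.
  by rewrite ord1 mxE Is ?mem_enum.
apply: spec_cseqs => // pre i s1 l [-> v0 e0 e4 Is].
have a1 : has_bits (arr s1 4) x by rewrite e4.
have a01 : arr s1 0 = arr (input W) 0 by rewrite e0.
apply: (spec_weaken (spec_coordinate i v0 a01 a1)) => s2 _ [f g] [-> zi oz].
split; rewrite ?f// ?(g 0%N)// ?(g 4%N)// => k; rewrite mem_rcons inE.
have [->//|ki /= kp] := eqVneq k i.
by rewrite oz ?Is// eqz_nat.
Qed.

Definition greedy_solution h : vec01 n :=
  greedy_from indep (zero_vec n) (value_order h).

Definition greedy_log h : seq (event n) :=
  Objective (weights h)
    :: [seq Query q | q <- greedy_queries indep (zero_vec n) (value_order h)].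

Lemma spec_solve_linear h s :
    var s 0 = n -> arr s 0 = arr (input W) 0 ->
  spec (solve_linear p h) s (fun s' l => [/\ l = greedy_log h,
    has_bits (arr s' 4) (greedy_solution h) &
    read_point d s' 5 = image_int (greedy_solution h)]).
Proof.
move=> s0 a0; apply: (spec_seq (spec_set_weights h s0 a0)).
move=> s1 l1 [f1 g1] [-> w1]; have v1 : var s1 0 = n by rewrite f1.
apply: (spec_seq (spec_reset v1)) => s2 l2 [f2 g2] [-> x2].
have v2 : var s2 0 = n by rewrite f2.
apply: spec_seq.
  by apply: (spec_greedy (h := h) v2 _ x2) => j; rewrite g2.
move=> s3 l3 [f3 g3] [-> x3].
have v3 : var s3 0 = n.
  by rewrite f3//; apply: wvars_cseqs.
have a3 : arr s3 0 = arr (input W) 0.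
  by rewrite g3; [rewrite g2// g1|apply: warrs_cseqs].
apply: (spec_weaken (spec_set_image v3 a3 x3)) => s4 l4 [f4 g4] [-> p4].
split=> //; first by rewrite !cats0.
by rewrite g4//; apply: warrs_cseqs.
Qed.

Lemma spec_update_best s (x : vec01 n) :
    var s 0 = n -> has_bits (arr s 4) x -> read_point d s 5 = image_int x ->
  spec (update_best d) s (fun s' l => l = [::] /\
    if (var s 5 < 1) || comp (read_point d s 6) (image_int x) then
      [/\ var s' 5 = 1, has_bits (arr s' 1) x & read_point d s' 6 = image_int x]
    else [/\ var s' 5 = var s 5, arr s' 1 = arr s 1 & arr s' 6 = arr s 6]).
Proof.
move=> s0 ax px.
have comp_s : spec compare s (fun s' l => l = [::] /\
    var s' 4 = ((var s 5 < 1) || comp (read_point d s 6) (image_int x) : bool)%:Z).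
  apply: spec_if => /=; case: ifP => _ /=; first exact: spec_set.
  by apply: spec_comp; rewrite /= px.
apply: (spec_seq comp_s).
move=> s1 l1 [f1 g1] [-> v4] {l1}; apply: spec_if; rewrite /= v4.
case: (_ || _) => /=; last by apply: spec_skip; split=> //; rewrite f1 ?g1.
have v1 : var s1 0 = n by rewrite f1.
have ax1 : has_bits (arr s1 4) x by rewrite g1.
apply: spec_seq.
  apply: (spec_for (Inv := fun pre A l => l = [::] /\
    forall j : 'I_n, j \in pre -> A 1%N (j : nat)%:Z = (x j : nat)%:Z)) => //.
  move=> pre j s2 l v02 v12 fr [-> Is]; apply: spec_put; split=> // k.
  rewrite mem_rcons inE /= /upd eqxx v12 eqz_nat (inj_eq (@ord_inj n)) fr// ax1.
  by case: eqVneq => [->//|_] /= /Is.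
move=> s2 l2 [f2 g2] [-> b2] {l2}.
pose Inv (pre : seq 'I_d) s' (l : seq (event n)) := [/\ l = [::],
  arr s' 5 = arr s1 5, arr s' 1 = arr s2 1 &
  forall i : 'I_d, i \in pre -> arr s' 6 (i : nat)%:Z = image_int x i 0].
have save_s : spec (cseqs [seq CPut 6 (EConst i%:Z) (EGet 5 (EConst i%:Z))
                         | i <- iota 0 d]) s2 (Inv (enum 'I_d)).
  rewrite -val_enum_ord -map_comp; apply: spec_cseqs; last by split=> //; rewrite g2.
  move=> pre i s3 l [-> e5 e1 Is]; apply: spec_put; split=> //= k.
  rewrite mem_rcons inE /upd /= eqz_nat (inj_eq (@ord_inj d)) e5 g1//.
  case: eqVneq => [->|_] /=; last exact: Is.
  by move/matrixP/(_ i 0): px; rewrite mxE.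
apply: (spec_seq save_s) => s3 l3 _ [-> _ e1 Is]; apply: spec_set; split=> //.
split=> //= [j|]; first by rewrite e1 b2 ?mem_enum.
by apply/matrixP => i j; rewrite ord1 mxE /= Is ?mem_enum.
Qed.

Lemma frame_solve_linear (h : 'rV[int]_d) s s' : frame (solve_linear p h) s s' ->
  [/\ var s' 0 = var s 0, var s' 5 = var s 5, arr s' 0 = arr s 0,
      arr s' 1 = arr s 1 & arr s' 6 = arr s 6].
Proof.
move=> [f g].
have nv v : v \in [:: 0; 5]%N -> ~~ wvars (solve_linear p h) v.
  rewrite !inE => /orP[]/eqP->; rewrite /= negb_or;
  by apply/andP; split; apply: wvars_cseqs.
have na a : a \in [:: 0; 1; 6]%N -> ~~ warrs (solve_linear p h) a.
  rewrite !inE => /or3P[]/eqP->; rewrite /= negb_or;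
  by apply/andP; split; apply: warrs_cseqs.
by split; rewrite ?f ?g ?nv ?na.
Qed.

Lemma frame_update_best s s' : frame (update_best d) s s' ->
  var s' 0 = var s 0 /\ arr s' 0 = arr s 0.
Proof.
move=> [f g]; split; first by apply: f; rewrite /= !orbF; apply: wvars_cseqs.
by apply: g; rewrite /= !orbF; apply: warrs_cseqs.
Qed.

(** The oracle enters only through the order it induces on the values [F x]. Positivity of [m]
    ensures that some solution has been saved in the output array. *)
Lemma spec_solve_convex (K : realDomainType) (F : vec01 n -> K) m
    (hs : 'I_m -> 'rV[int]_d) :
    (forall x y, comp (image_int x) (image_int y) = (F x < F y)) ->
  spec (solve_convex p hs) (input W) (fun s l =>
    l = flatten [seq greedy_log (hs k) | k <- enum 'I_m] /\
    ((0 < m)%N -> exists k, output n s = greedy_solution (hs k) /\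
       forall i, F (greedy_solution (hs i)) <= F (greedy_solution (hs k)))).
Proof.
move=> compE; pose sol k := greedy_solution (hs k).
pose best (pre : seq 'I_m) s k := [/\ var s 5 = 1, has_bits (arr s 1) (sol k),
  read_point d s 6 = image_int (sol k) &
  forall i, i \in pre -> F (sol i) <= F (sol k)].
(* Either nothing has been processed and flag 5 is still 0, or the saved solution is the best among
   those of [pre]. *)
pose Inv (pre : seq 'I_m) s l := [/\ var s 0 = n, arr s 0 = arr (input W) 0,
  l = flatten [seq greedy_log (hs k) | k <- pre] &
  (pre = [::] /\ var s 5 = 0) \/ exists k, best pre s k].
apply: (spec_weaken (Q := Inv (enum 'I_m))); last first.
  move=> s l _ [_ _ -> H]; split=> // m_gt0.
  case: H => [[e _]|[k [_ b1 _ le_k]]].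
    by have := size_enum_ord m; rewrite e => m0; rewrite -m0 in m_gt0.
  by exists k; split=> [|i]; [exact: has_bits_read|apply: le_k; rewrite mem_enum].
apply: spec_cseqs; last by split=> //; left.
move=> pre k s l [v0 a0 -> H].
apply: (spec_seq (spec_solve_linear (hs k) v0 a0)) => s1 l1 fr1 [-> b4 p5].
have [f0 f5 g0 g1 g6] := frame_solve_linear fr1.
have v01 : var s1 0 = n by rewrite f0.
apply: (spec_weaken (spec_update_best v01 b4 p5)) => s2 l2 fr2 [-> upd2].
have [f02 g02] := frame_update_best fr2.
split; rewrite ?f02 ?g02 ?g0//.
  by rewrite cats0 map_rcons flatten_rcons.
right; have p6 : read_point d s1 6 = read_point d s 6.
  by apply/matrixP => i j; rewrite !mxE g6.
move: upd2; rewrite f5 p6; case: H => [[-> ->]|[i [-> b1 b6 le_i]]] /=.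
  move=> [v5 b1 b6]; exists k; split=> // i; rewrite inE => /eqP->.
  exact: lexx.
rewrite b6 compE; case: ltP => [lt_ik [v5 c1 c6]|le_ki [v5 c1 c6]].
  exists k; split=> // j; rewrite mem_rcons inE => /orP[/eqP->//|/le_i le_ji].
  exact: le_trans le_ji (ltW lt_ik).
exists i; split; rewrite ?v5 ?c1 ?g1//.
  by rewrite -b6; apply/matrixP => j j'; rewrite !mxE c6 g6.
by move=> j; rewrite mem_rcons inE => /orP[/eqP->|/le_i].
Qed.

End Correctness.

(** * The extremal number and the algorithm combined *)

Lemma image_int_vec (R : realType) d p n (W : 'M['I_p.+1]_(d, n)) (x : vec01 n) :
  map_mx intr (image_int W x) = image_vec R W x.
Proof.
apply/matrixP => i j; rewrite ord1 !mxE rmorph_sum; apply: eq_bigr => l _.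
by rewrite !mxE rmorphM.
Qed.

Theorem theorem4p1 (R : realType) (d p : nat) (d_gt0 : (0 < d)%N)
    (p_gt0 : (0 < p)%N) :
  exists m : nat,
    ((exists (n : nat) (S : {set vec01 n}) (W : 'M['I_p.+1]_(d, n)),
        is_matroid S /\
        (vertices (conv_hull (image_set R W S)) #= `I_m)%card) /\
     (forall (n : nat) (S : {set vec01 n}) (W : 'M['I_p.+1]_(d, n)),
        is_matroid S ->
        exists2 k : nat, (k <= m)%N &
          (vertices (conv_hull (image_set R W S)) #= `I_k)%card)) /\
    (exists (P : cmd) (c : nat),
       forall (n : nat) (S : {set vec01 n}) (W : 'M['I_p.+1]_(d, n))
              (f : 'cV[R]_d -> R),
         is_matroid S -> convex_function setT f ->
         solves_by_greedy P m (c * n.+1 ^ c) W S f).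
Proof.
have [hs [_ _ hs_surj]] := chamber_representatives d p.
have [K [e costP]] := cost_polynomial d (solve_convex p hs).
exists #|chambers d p|; split; first split.
- exists _, (zonotope_matroid d p), (zonotope_weights d p); split.
    exact: is_matroid_zonotope.
  exact: card_vertices_zonotope.
- move=> n S W matS.
  exact: (card_vertices_le R hs_surj matS (fun k => value_order_perm W (hs k))
            (fun k => value_order_sorted W (hs k))).
(* A single constant has to serve as factor and exponent; [K + e] dominates both. *)
exists (solve_convex p hs), (K + e)%N => n S W f matS cf.
have compE x y : comparison f (image_int W x) (image_int W y) =
    (f (image_vec R W x) < f (image_vec R W y)).
  by rewrite /comparison !image_int_vec.
have [s [t [l [ex tc [lE best]]]]] := spec_solve_convex (independent S) hs compE.
have sol_max k := greedy_optimal matS (value_order_perm W (hs k))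
  (value_order_sorted W (hs k)).
(* The functional 0 yields an index [k0], which shows that there is at least one chamber. *)
have [k0 _] := greedy_chamber_maximizer hs_surj matS
  (fun k => value_order_perm W (hs k)) (fun k => value_order_sorted W (hs k))
  (0 : 'rV[R]_d).
have [|k [outk le_k]] := best; first exact: leq_ltn_trans (ltn_ord k0).
pose x k := greedy_solution W (independent S) (hs k).
exists s, t, l, (fun k => weights W (hs k)), x,
  (fun k => greedy_log W (independent S) (hs k)); split=> //.
- apply: leq_trans tc (leq_trans (costP n) _); apply: leq_mul.
    exact: leq_addr.
  by apply: leq_pexp2l => //; apply: leq_addl.
- rewrite outk; split; first by case: (sol_max k).
  (* Some greedy solution is at least as good as [z] for [f], and the saved one is at least as good
     as that. *)
  move=> z zS; have [i le_zi] := convex_maximizer hs_surj matS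
    (fun k => value_order_perm W (hs k)) (fun k => value_order_sorted W (hs k)) cf zS.
  exact: le_trans le_zi (le_k i).
split; last by exists k.
move=> i; have [xS maxx] := sol_max i; split.
  exists (value_order W (hs i)); split=> //; first exact: value_order_perm.
  by apply: sub_sorted (value_order_sorted W (hs i)) => a b; rewrite !ffunE.
split=> // z zS; have := maxx z zS; rewrite /linear_value.
by congr (_ <= _); apply: eq_bigr => j _; rewrite ffunE.
Qed.
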